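(* Let $A=\bigcap_{i=1}^{N}A_i$ and $B=\bigcap_{j=1}^{N}B_j$ be two nonempty convex polyhedra in $\mathbb{R}^d$, where each $A_i$ and each $B_j$ is a closed half-space of $\mathbb{R}^d$ or the entire space $\mathbb{R}^d$ (repetitions allowed), and extend the families cyclically to all positive integer indices with period $N$. Let $(\lambda_n)_{n\ge 1}$ be a sequence of real numbers such that $$\lim_{n\to\infty}\lambda_n=0,\qquad \sum_{n}\lambda_n=\infty,\qquad \sum_{n}|\lambda_n-\lambda_{n+N}|<\infty .$$ Let $(n_k)_{k\ge 0}$ be a non-decreasing sequence of natural numbers such that $$n_k\to\infty\qquad\text{and}\qquad \sup_{k_0\ge 0}\ \sum_{k>k_0}\ \prod_{n=n_{k_0}+1}^{n_k}(1-\lambda_n)<\infty .$$ Let $a_0\in\mathbb{R}^d$ be an arbitrary point and let $a'_0,b'_1,a'_2,b'_3,\dots$ be an auxiliary sequence of points $a'_{2k},b'_{2k+1}\in\mathbb{R}^d$ $(k\ge 0)$ that is bounded. Define recursively (the A-HLWB algorithm) $$b_{k+1}=Q_{B,n_k}(a_k;a'_k)\ \text{ if } k \text{ is even},\qquad a_{k+1}=Q_{A,n_k}(b_k;b'_k)\ \text{ if } k \text{ is odd},$$ where $Q_{A,n}$ and $Q_{B,n}$ are the HLWB operators associated with $(A_i)$, $(B_j)$ and $(\lambda_n)$. Then the pairs $(a_{2k},b_{2k+1})$ converge, as $k\to\infty$, to a best approximation pair relative to $(A,B)$.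
   Context: $\mathbb{R}^d$ is $d$-dimensional Euclidean space with norm $\lVert\cdot\rVert$. A best approximation pair relative to two closed convex sets $A$ and $B$ is a pair $(a,b)\in A\times B$ with $\lVert a-b\rVert=\min\{\lVert x-y\rVert : x\in A,\ y\in B\}$. For a nonempty closed convex set $C$, $P_C$ denotes the metric projection onto $C$ (so $P_{\mathbb{R}^d}$ is the identity). Cyclic extension: $A_i=A_{i\bmod N}$ and $B_j=B_{j\bmod N}$ for all positive integers $i,j$, where the $\bmod\,N$ function takes values in $\{1,2,\dots,N\}$. (Taking the same number $N$ of sets for $A$ and $B$ is no restriction, since one may add copies of $\mathbb{R}^d$ or repeat half-spaces.) HLWB (Halpern–Lions–Wittmann–Bauschke) operators: for $a,b,x\in\mathbb{R}^d$ and $n\ge 1$, $$Q_{B,0}(a;x)=x,\qquad Q_{B,n}(a;x)=\lambda_n a+(1-\lambda_n)P_{B_n}\bigl(Q_{B,n-1}(a;x)\bigr),$$ $$Q_{A,0}(b;x)=x,\qquad Q_{A,n}(b;x)=\lambda_n b+(1-\lambda_n)P_{A_n}\bigl(Q_{A,n-1}(b;x)\bigr).$$ An empty product equals $1$.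
   Formalization: The parameters λ_n are additionally assumed to be nonnegative for all sufficiently large n; if infinitely many λ_n may be negative, the claim as stated is false (the iterates can be unbounded). *)

(* Defs.v *)
From HB Require Import structures.
From mathcomp Require Export all_boot all_order all_algebra.
From mathcomp Require Export all_classical all_reals all_analysis.

Set Implicit Arguments.
Unset Strict Implicit.
Unset Printing Implicit Defensive.

Export numFieldNormedType.Exports.
Import Order.TTheory GRing.Theory Num.Theory.
Local Open Scope classical_set_scope.
Local Open Scope ring_scope.

Section Euclidean.
Variables (R : realType) (d : nat).
Implicit Types (x y p u a b : 'rV[R]_d) (C S A B : set 'rV[R]_d).

Definition dotp x y : R := \sum_(i < d) x 0 i * y 0 i.

(* The library norm `|x| on 'rV[R]_d is the maximum norm. Both norms induce
   the topology carried by 'rV[R]_d, so convergence is the library's. *)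
Definition enorm x : R := Num.sqrt (dotp x x).

Definition closed_halfspace S : Prop :=
  exists u (c : R), u != 0 /\ S = [set x | dotp u x <= c].

Definition halfspace_or_full S : Prop := closed_halfspace S \/ S = setT.

(* Meaningful for C nonempty, closed and convex, where the minimizer exists
   and is unique; an unspecified point when there is no minimizer. *)
Definition proj C x : 'rV[R]_d :=
  get [set p | C p /\ forall y, C y -> enorm (x - p) <= enorm (x - y)].

Definition best_approx_pair A B a b : Prop :=
  [/\ A a, B b & forall x y, A x -> B y -> enorm (a - b) <= enorm (x - y)].

End Euclidean.

(* Representative of n >= 1 modulo N, with values in {1, ..., N}. *)
Definition mod1 (N n : nat) : nat := (n.-1 %% N).+1.

(* The family is indexed from 1; only C 1, ..., C N are used. *)
Definition polyhedron (R : realType) (d N : nat) (C : nat -> set 'rV[R]_d) :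
    set 'rV[R]_d :=
  \bigcap_(i in [set i | (1 <= i <= N)%N]) C i.

(* Halpern-Lions-Wittmann-Bauschke operator Q_{C,n}(a; x), with anchor a and
   starting point x, for the N-periodic extension of C 1, ..., C N. *)
Fixpoint hlwb (R : realType) (d N : nat) (lam : nat -> R)
    (C : nat -> set 'rV[R]_d) (n : nat) (a x : 'rV[R]_d) : 'rV[R]_d :=
  if n is m.+1 then
    lam m.+1 *: a
    + (1 - lam m.+1) *: proj (C (mod1 N m.+1)) (hlwb N lam C m a x)
  else x.

(* Main.v *)
(* The distance from Q_(A,n)(a + v; .) to a, for a best approximation pair
   (a, a + v), is of order lambda_n, which need not be summable along n_k. The
   half-steps x_(k+1) = Q_(n_k)(x_k; x'_k) are therefore compared not with a
   fixed pair but with an orbit y_k of the same algorithm that stays close to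
   the pair: the HLWB operators do not expand x_k - y_k, except for the memory
   of the auxiliary points, which is controlled by the products of the
   1 - lambda_n and is summable. So |x_k - y_k| decreases up to a summable
   error.

   Such an orbit exists if as few constraints as possible bind at (a, a + v).
   Drop the constraints that do not bind. The orbit of the remaining system
   started at the pair stays orthogonal to the common lineality space of the
   binding constraints, and on that slice (a, a + v) is the only best pair;
   by compactness, alternating projections then map a ball around a into a
   smaller one, which absorbs the HLWB errors, and close to the pair the dropped
   constraints do not act. Any best pair is a limit of such pairs, so x_k is
   quasi-Fejer monotone with respect to all of them. Since alternating
   projections strictly decrease the distance to a except at points that belong
   to a best pair, every cluster point of x_(2k) belongs to one, and the
   sequence converges. *)
Require Import Defs.
From mathcomp Require Import ring lra.
Import Order.TTheory GRing.Theory Num.Theory.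

Local Open Scope classical_set_scope.
Local Open Scope ring_scope.

Set Implicit Arguments.
Unset Strict Implicit.
Unset Printing Implicit Defensive.

(** * Euclidean geometry and projections *)

Section InnerProduct.
Variables (R : realType) (d : nat).
Implicit Types (x y z : 'rV[R]_d) (t : R).

Lemma dotpC x y : dotp x y = dotp y x.
Proof. by apply: eq_bigr => i _; rewrite mulrC. Qed.

Lemma dotpDl x y z : dotp (x + y) z = dotp x z + dotp y z.
Proof. by rewrite -big_split; apply: eq_bigr => i _; rewrite mxE mulrDl. Qed.

Lemma dotpZl t x y : dotp (t *: x) y = t * dotp x y.
Proof. by rewrite mulr_sumr; apply: eq_bigr => i _; rewrite mxE mulrA. Qed.

Lemma dotpNl x y : dotp (- x) y = - dotp x y.
Proof. by rewrite -scaleN1r dotpZl mulN1r. Qed.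

Lemma dotp0l y : dotp 0 y = 0.
Proof. by rewrite -(scale0r 0) dotpZl mul0r. Qed.

Lemma dotpDr x y z : dotp z (x + y) = dotp z x + dotp z y.
Proof. by rewrite dotpC dotpDl !(dotpC _ z). Qed.

Lemma dotpZr t x y : dotp x (t *: y) = t * dotp x y.
Proof. by rewrite dotpC dotpZl dotpC. Qed.

Lemma dotpNr x y : dotp x (- y) = - dotp x y.
Proof. by rewrite dotpC dotpNl dotpC. Qed.

Lemma dotp0r x : dotp x 0 = 0.
Proof. by rewrite dotpC dotp0l. Qed.

Definition dotpE := (dotpDl, dotpDr, dotpNl, dotpNr, dotpZl, dotpZr).

Lemma dotp_ge0 x : 0 <= dotp x x.
Proof. by apply: sumr_ge0 => i _; rewrite -expr2 sqr_ge0. Qed.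

Lemma coord_sqr_le x i : x 0 i ^+ 2 <= dotp x x.
Proof.
rewrite /dotp (bigD1 i)//= expr2 lerDl sumr_ge0// => j _.
by rewrite -expr2 sqr_ge0.
Qed.

Lemma dotp_eq0 x : dotp x x <= 0 -> x = 0.
Proof.
move=> x0; apply/rowP => i; rewrite mxE; apply/eqP; rewrite -sqrf_eq0.
by rewrite eq_le sqr_ge0 (le_trans (coord_sqr_le x i)).
Qed.

Lemma sqr_enorm x : enorm x ^+ 2 = dotp x x.
Proof. by rewrite sqr_sqrtr ?dotp_ge0. Qed.

Lemma enorm_ge0 x : 0 <= enorm x.
Proof. exact: sqrtr_ge0. Qed.

Lemma enorm0 : enorm (0 : 'rV[R]_d) = 0.
Proof. by rewrite /enorm dotp0l sqrtr0. Qed.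

Lemma enorm_le0 x : enorm x <= 0 -> x = 0.
Proof.
move=> x0; apply: dotp_eq0; rewrite -sqr_enorm.
have -> : enorm x = 0 by have := enorm_ge0 x; lra.
by rewrite expr0n.
Qed.

Lemma enorm_le x t : 0 <= t -> (enorm x <= t) = (dotp x x <= t ^+ 2).
Proof. by move=> t0; rewrite -sqr_enorm ler_sqr// nnegrE enorm_ge0. Qed.

Lemma enorm_lt x t : 0 <= t -> (enorm x < t) = (dotp x x < t ^+ 2).
Proof. by move=> t0; rewrite -sqr_enorm ltr_sqr// nnegrE enorm_ge0. Qed.

Lemma le_enorm x y : (enorm x <= enorm y) = (dotp x x <= dotp y y).
Proof. by rewrite enorm_le ?enorm_ge0// sqr_enorm. Qed.

Lemma enormZ t x : enorm (t *: x) = `|t| * enorm x.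
Proof.
by rewrite /enorm dotpZl dotpZr mulrA -expr2 sqrtrM ?sqr_ge0// sqrtr_sqr.
Qed.

Lemma enormN x : enorm (- x) = enorm x.
Proof. by rewrite /enorm dotpNl dotpNr opprK. Qed.

Lemma enormC x y : enorm (x - y) = enorm (y - x).
Proof. by rewrite -enormN opprB. Qed.

Lemma dotp_le x y : dotp x y <= enorm x * enorm y.
Proof.
have [x0|x0] := eqVneq (enorm x) 0.
  by rewrite x0 mul0r [x]enorm_le0 ?x0// dotp0l.
have [y0|y0] := eqVneq (enorm y) 0.
  by rewrite y0 mulr0 [y]enorm_le0 ?y0// dotp0r.
have {}x0 : 0 < enorm x by rewrite lt_def x0 enorm_ge0.
have {}y0 : 0 < enorm y by rewrite lt_def y0 enorm_ge0.
have := dotp_ge0 (enorm y *: x - enorm x *: y).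
rewrite !dotpE (dotpC y x) -!sqr_enorm => h.
have xy0 := mulr_gt0 x0 y0.
rewrite -(ler_pM2l xy0) -subr_ge0.
by nra.
Qed.

Lemma dotp_abs_le x y : `|dotp x y| <= enorm x * enorm y.
Proof.
rewrite ler_norml dotp_le andbT -[X in _ <= X]opprK lerN2 -dotpNl.
by rewrite (le_trans (dotp_le _ _))// enormN.
Qed.

Lemma enormD x y : enorm (x + y) <= enorm x + enorm y.
Proof.
rewrite enorm_le ?addr_ge0 ?enorm_ge0// sqrrD !sqr_enorm !dotpE (dotpC y x).
by have := dotp_le x y; lra.
Qed.

Lemma enormB_le x y : enorm (x - y) <= enorm x + enorm y.
Proof. by rewrite (le_trans (enormD _ _))// enormN. Qed.

Lemma enorm_triangle z x y : enorm (x - y) <= enorm (x - z) + enorm (z - y).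
Proof. by rewrite (le_trans _ (enormD _ _))// addrA subrK. Qed.

Lemma enorm_convex t x y : 0 <= t <= 1 ->
  enorm (t *: x + (1 - t) *: y) <= t * enorm x + (1 - t) * enorm y.
Proof.
move=> /andP[t0 t1]; rewrite (le_trans (enormD _ _))// !enormZ.
by rewrite !ger0_norm// subr_ge0.
Qed.

Lemma norm_le_enorm x : `|x| <= enorm x.
Proof.
rewrite [leLHS]/Num.Def.normr/= mx_normrE (bigmax_le _ (enorm_ge0 x))//=.
move=> [i j] _ /=; rewrite ord1 -ler_sqr ?nnegrE ?normr_ge0 ?enorm_ge0//.
by rewrite real_normK ?num_real// sqr_enorm coord_sqr_le.
Qed.

Lemma enorm_le_norm x : enorm x <= d%:R * `|x|.
Proof.
have co i : `|x 0 i| <= `|x|.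
  by rewrite [leRHS]/Num.Def.normr/= mx_normrE (le_bigmax _ _ (0, i)).
have : dotp x x <= d%:R * `|x| ^+ 2.
  rewrite /dotp (le_trans (y := \sum_(i < d) `|x| ^+ 2))//.
    apply: ler_sum => i _; rewrite -expr2 -real_normK ?num_real//.
    by rewrite ler_sqr ?nnegrE.
  by rewrite sumr_const card_ord mulr_natl.
move=> h; rewrite enorm_le ?mulr_ge0// exprMn (le_trans h)//.
rewrite ler_wpM2r ?sqr_ge0// expr2 -natrM ler_nat.
by case: (d) => // n; rewrite leq_pmulr.
Qed.

(** Bolzano-Weierstrass in sequential form, from compactness of the box [[- M, M]] in each
    coordinate; all compactness arguments below go through it. *)
Lemma enorm_cluster (x : nat -> 'rV[R]_d) (M : R) :
  (forall n, enorm (x n) <= M) ->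
  exists p : 'rV[R]_d, forall e : R, 0 < e ->
    forall n, exists m, (n <= m)%N /\ enorm (x m - p) < e.
Proof.
move=> xM.
have cpt := @rV_compact R d (fun=> `[- M, M]%classic) (fun=> @segment_compact _ _ _).
have [|p [_ clp]] := cpt (x n @[n --> \oo]) _.
  exists 0%N => // n _ i /=; rewrite in_itv/= -ler_norml (le_trans _ (xM n))//.
  rewrite -ler_sqr ?nnegrE ?normr_ge0 ?enorm_ge0//.
  by rewrite real_normK ?num_real// sqr_enorm coord_sqr_le.
exists p => e e0 n.
(* [d.+1] keeps the divisor positive when [d = 0]. *)
have De : 0 < e / d.+1%:R by rewrite divr_gt0.
have [||y [[m /= nm <-] pm]] :=
    clp [set x m | m in [set m | (n <= m)%N]] (ball p (e / d.+1%:R)).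
- by exists n => // m nm; exists m.
- exact: nbhsx_ballx.
exists m; split=> //; rewrite enormC (le_lt_trans (enorm_le_norm _))//.
rewrite mx_norm_ball /ball_/= ltr_pdivlMr// mulrC in pm.
by rewrite (le_lt_trans _ pm)// ler_wpM2r ?normr_ge0// ler_nat.
Qed.

End InnerProduct.

Lemma vanishing_seq (R : realType) : exists u : nat -> R,
  (forall k, 0 < u k <= 1) /\
  forall e : R, 0 < e -> exists K, forall k, (K <= k)%N -> u k < e.
Proof.
exists (fun k => k.+1%:R^-1); split=> [k|e e0].
  by rewrite invr_gt0 ltr0n/= invf_le1 ?ler1n.
by have [K _ HK] := near_infty_natSinv_lt (PosNum e0); exists K.
Qed.

Lemma le_of_lt_addr (R : realType) (x y : R) :
  (forall e : R, 0 < e -> x < y + e) -> x <= y.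
Proof. by move=> h; apply/ler_addgt0Pr => e /h/ltW. Qed.

Lemma approx_inf (R : realType) (T : Type) (C : set T) (f : T -> R) :
  C !=set0 -> (forall x, 0 <= f x) ->
  exists m, (forall x, C x -> m <= f x) /\
    forall e : R, 0 < e -> exists x, C x /\ f x < m + e.
Proof.
move=> [x0 Cx0] f0; have lb : has_lbound (f @` C) by exists 0 => _ [x _ <-].
exists (inf (f @` C)); split=> [x Cx|e e0].
  by apply: ge_inf => //; exists x.
have [|_ [x Cx <-] fx] := inf_adherent e0 (E := f @` C); last by exists x.
by split=> //; exists (f x0), x0.
Qed.

(** Nonemptiness is included because [proj] is meaningful only then. *)
Definition closed_convex (R : realType) d (C : set 'rV[R]_d) :=
  [/\ C !=set0, closed C & forall x y t, 0 <= t <= 1 ->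
    C x -> C y -> C (t *: x + (1 - t) *: y)].

Section Projection.
Variables (R : realType) (d : nat).
Implicit Types (x y p q h u : 'rV[R]_d) (C : set 'rV[R]_d).

Lemma closed_enormP C : closed C <->
  forall x, (forall e : R, 0 < e -> exists y, C y /\ enorm (y - x) < e) -> C x.
Proof.
split=> [cC x h|h x clx].
  apply: cC => B /nbhs_ballP[e /= e0 xB]; have [y [Cy yx]] := h _ e0.
  exists y; split=> //; apply: xB; rewrite mx_norm_ball /ball_/=.
  by rewrite (le_lt_trans (norm_le_enorm _))// enormC.
apply: h => e e0; have De : 0 < e / d.+1%:R by rewrite divr_gt0.
have [y [Cy]] := clx _ (nbhsx_ballx x _ De).
rewrite mx_norm_ball /ball_/= ltr_pdivlMr// mulrC => xy; exists y; split=> //.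
rewrite enormC (le_lt_trans (enorm_le_norm _))// (le_lt_trans _ xy)//.
by rewrite ler_wpM2r// ler_nat.
Qed.

Lemma enorm_cluster_closed C (x : nat -> 'rV[R]_d) p : closed C ->
  (forall n, C (x n)) ->
  (forall e : R, 0 < e -> forall n, exists m, (n <= m)%N /\ enorm (x m - p) < e) ->
  C p.
Proof.
move=> /closed_enormP cC Cx clp; apply: cC => e e0.
by have [m [_ xp]] := clp _ e0 0%N; exists (x m).
Qed.

(** A minimizing sequence is bounded; its cluster point lies in [C] by closedness and attains the
    infimum. *)
Lemma proj_min C x : closed_convex C ->
  C (proj C x) /\ forall y, C y -> enorm (x - proj C x) <= enorm (x - y).
Proof.
move=> [C0 cC _]; apply: (getPex (P := [set p | C p /\
  forall y, C y -> enorm (x - p) <= enorm (x - y)])).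
have [m [mle mlt]] := approx_inf C0 (fun y => enorm_ge0 (x - y)).
have [w [w01 wlt]] := vanishing_seq R.
have [y yP] := choice (fun k : nat => mlt (w k) (proj1 (andP (w01 k)))).
have [|p clp] := enorm_cluster (x := y) (M := enorm x + (m + 1)).
  move=> k; have [_ yk] := yP k; rewrite -[y k](subKr x).
  by have := enormB_le x (x - y k); have /andP[_] := w01 k; lra.
have Cp : C p by apply: (enorm_cluster_closed cC _ clp) => k; case: (yP k).
exists p; split=> // z Cz; apply: le_trans (mle _ Cz).
apply: le_of_lt_addr => e e0.
have e20 : 0 < e / 2 by lra.
have [K HK] := wlt _ e20; have [k [/HK kK ykp]] := clp _ e20 K.
have [_ yk] := yP k; have := enorm_triangle (y k) x p; lra.
Qed.

Lemma proj_in C x : closed_convex C -> C (proj C x).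
Proof. by move=> cC; have [] := proj_min x cC. Qed.

Lemma proj_var C x y : closed_convex C -> C y ->
  dotp (x - proj C x) (y - proj C x) <= 0.
Proof.
move=> cC Cy; have [Cp pmin] := proj_min x cC; set p := proj C x in Cp pmin *.
rewrite leNgt; apply/negP => s0.
set s := dotp _ _ in s0; have n0 := dotp_ge0 (y - p).
set n := dotp (y - p) (y - p) in n0.
(* Moving from [p] towards [y] by [t] changes the squared distance to [x] by [t * (t * n - 2 * s)],
   which is negative because [t * n = s - t * s]. *)
pose t := s / (s + n).
have sn0 : 0 < s + n by lra.
have t0 : 0 < t by rewrite divr_gt0.
have t1 : t <= 1 by rewrite ler_pdivrMr//; lra.
have tE : t * s + t * n = s by rewrite -mulrDr divfK// gt_eqF.
have [_ _ cv] := cC.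
have /pmin : C (t *: y + (1 - t) *: p) by apply: cv => //; rewrite (ltW t0).
have -> : x - (t *: y + (1 - t) *: p) = (x - p) - t *: (y - p).
  by apply/rowP => i; rewrite !mxE; ring.
rewrite le_enorm [X in _ <= X]dotpDl !(dotpDr (x - p) (- _)).
rewrite !dotpNl !dotpNr !dotpZl !dotpZr opprK (dotpC (y - p)) -/s -/n.
have tn0 : 0 <= t * n by rewrite mulr_ge0// ltW.
have := mulr_gt0 t0 s0.
by nra.
Qed.

(** The variational inequalities of [p] and of [proj C x], each tested at the other point, add up to
    a nonpositive squared distance. *)
Lemma proj_unique C x p : closed_convex C -> C p ->
  (forall y, C y -> dotp (x - p) (y - p) <= 0) -> proj C x = p.
Proof.
move=> cC Cp pvar; have := pvar _ (proj_in x cC); have := proj_var x cC Cp.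
set q := proj C x => h1 h2; apply/subr0_eq; apply: dotp_eq0.
move: h1 h2; rewrite !dotpE (dotpC q p); lra.
Qed.

Lemma proj_id C x : closed_convex C -> C x -> proj C x = x.
Proof.
by move=> cC Cx; apply: proj_unique => // y _; rewrite subrr dotp0l.
Qed.

Lemma proj_firm C x y : closed_convex C ->
  dotp (proj C x - proj C y) (proj C x - proj C y) <=
  dotp (x - y) (proj C x - proj C y).
Proof.
move=> cC; have := proj_var x cC (proj_in y cC).
have := proj_var y cC (proj_in x cC); rewrite !dotpE.
rewrite (dotpC (proj C y) (proj C x)); lra.
Qed.

Lemma proj_nonexp C x y : closed_convex C ->
  enorm (proj C x - proj C y) <= enorm (x - y).
Proof.
move=> cC; have := proj_firm x y cC; set p := _ - _ => h.
have := dotp_le (x - y) p; have := enorm_ge0 p; rewrite -sqr_enorm in h => p0 h2.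
have [p1|] := ltP 0 (enorm p); last by have := enorm_ge0 (x - y); lra.
by rewrite -(ler_pM2r p1) -expr2 (le_trans h).
Qed.

Lemma proj_fejer C x q : closed_convex C -> C q ->
  dotp (proj C x - q) (proj C x - q) <=
  dotp (x - q) (x - q) - dotp (x - proj C x) (x - proj C x).
Proof.
move=> cC Cq; have := proj_var x cC Cq; rewrite !dotpE.
rewrite (dotpC q x) (dotpC (proj C x) x) (dotpC q (proj C x)); lra.
Qed.

(** Both [p + h] and [p - h] are test points in the variational inequality at the projection [p], so
    [x - p] is orthogonal to [h]. *)
Lemma proj_dir C x h : closed_convex C ->
  (forall y, C y -> C (y + h) /\ C (y - h)) -> dotp h (proj C x) = dotp h x.
Proof.
move=> cC Ch; have [Cp Cm] := Ch _ (proj_in x cC).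
have := proj_var x cC Cp; have := proj_var x cC Cm.
rewrite [_ + h]addrC [_ - h]addrC !addrK !dotpE ![dotp _ h]dotpC; lra.
Qed.

End Projection.

(** * Half-spaces and polyhedra *)

Section Polyhedra.
Variables (R : realType) (d : nat).
Implicit Types (x y p q h u : 'rV[R]_d) (C : set 'rV[R]_d).

(** One linear inequality covers both cases, the full space having zero normal and bound 1. *)
Lemma halfspace_or_fullP C : halfspace_or_full C ->
  C !=set0 /\ exists u c, C = [set x | dotp u x <= c] /\ (u = 0 -> 0 < c).
Proof.
case=> [[u [c [u0 ->]]]|->]; split.
- exists ((c / dotp u u) *: u); rewrite /= dotpZr divfK//.
  by apply: contra_neq u0 => h; apply: dotp_eq0; rewrite h.
- by exists u, c; split=> // u00; rewrite u00 eqxx in u0.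
- by exists 0.
- exists 0, 1; split=> //; apply/seteqP; split=> x //= _.
  by rewrite dotp0l.
Qed.

Lemma halfspace_closed u c : closed [set x | dotp u x <= c].
Proof.
apply/closed_enormP => x h /=; apply: le_of_lt_addr => e e0.
(* The added 1 avoids dividing by zero when [u = 0]; the same device recurs below. *)
have u1 : 0 < enorm u + 1 by rewrite ltr_wpDl ?enorm_ge0.
have [y [/= uy yx]] := h (e / (enorm u + 1)) (divr_gt0 e0 u1).
rewrite ltr_pdivlMr// in yx.
have -> : dotp u x = dotp u y - dotp u (y - x) by rewrite !dotpE; ring.
have := dotp_abs_le u (y - x); rewrite ler_norml => /andP[+ _].
have := enorm_ge0 u; have := enorm_ge0 (y - x); lra.
Qed.

Lemma halfspace_or_full_closed_convex C : halfspace_or_full C ->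
  closed_convex C.
Proof.
move=> /halfspace_or_fullP[C0 [u [c [CE _]]]]; rewrite CE in C0 *; split=> //.
  exact: halfspace_closed.
move=> x y t /andP[t0 t1] /= ux uy; rewrite !dotpE.
have : 0 <= 1 - t by lra.
by nra.
Qed.

Lemma polyhedron_closed_convex N (C : nat -> set 'rV[R]_d) :
  (forall i, (1 <= i <= N)%N -> closed_convex (C i)) ->
  polyhedron N C !=set0 -> closed_convex (polyhedron N C).
Proof.
move=> cC C0; split=> //.
  by apply: closed_bigI => i /cC[].
move=> x y t t01 Cx Cy i iN; have [_ _ cv] := cC _ iN.
by apply: cv => //; [exact: Cx|exact: Cy].
Qed.

End Polyhedra.

(** * Existence of a best approximation pair *)

(** Merges one positive threshold per constraint into a common one, their minimum. *)
Lemma finite_threshold (R : realType) (I : finType) (Q : I -> R -> Prop) :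
  (forall i x y, x <= y -> Q i y -> Q i x) ->
  (forall i, exists x, 0 < x /\ Q i x) -> exists x, 0 < x /\ forall i, Q i x.
Proof.
move=> mono /choice[f fP]; exists (\big[Order.min/1]_i f i); split=> [|i].
  by apply/bigmin_gtP; split=> // i _; case: (fP i).
by apply: mono (proj2 (fP i)); exact: bigmin_le_cond.
Qed.

(* If the least-norm minimizers z_k up to an error tending to 0 were unbounded,
   a limit h of z_k / |z_k| would be a direction along which the objective is
   constant, and z_k - h would be admissible and shorter than z_k. *)
Lemma polyhedron_linear_min (R : realType) (n d : nat) (I : finType)
    (u : I -> 'rV[R]_n) (c : I -> R) (f : {linear 'rV[R]_n -> 'rV[R]_d})
    (P := [set z | forall i, dotp (u i) z <= c i]) (kappa : R) :
  (forall z, enorm (f z) <= kappa * enorm z) -> P !=set0 ->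
  exists z, P z /\ forall w, P w -> enorm (f z) <= enorm (f w).
Proof.
move=> flip P0; have [m [mle mlt]] := approx_inf P0 (fun z => enorm_ge0 (f z)).
have [w [w01 wlt]] := vanishing_seq R.
pose S k := [set z | P z /\ enorm (f z) <= m + w k].
have kappa1 : 0 < `|kappa| + 1 by rewrite ltr_wpDl.
have {}flip z : enorm (f z) <= (`|kappa| + 1) * enorm z.
  have := flip z; have := enorm_ge0 z; have := ler_norm kappa; nra.
have cP x : (forall e : R, 0 < e -> exists y, P y /\ enorm (y - x) < e) -> P x.
  move=> h i; have /closed_enormP := @halfspace_closed R n (u i) (c i); apply.
  by move=> e /h[y [Py yx]]; exists y; split=> //; apply: Py.
have fcont x t : (forall e : R, 0 < e -> exists y, enorm (y - x) < e /\
    enorm (f y) < t + e) -> enorm (f x) <= t.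
  move=> h; apply: le_of_lt_addr => e e0.
  have [|y [yx fy]] := h (Num.min (e / 2) (e / 2 / (`|kappa| + 1))).
    by rewrite lt_min !divr_gt0.
  move: yx fy; rewrite lt_min => /andP[_]; rewrite ltr_pdivlMr// => yx.
  have : Num.min (e / 2) (e / 2 / (`|kappa| + 1)) <= e / 2 by rewrite ge_min lexx.
  have -> : f x = f y - f (y - x) by rewrite -linearB subKr.
  have := enormB_le (f y) (f (y - x)); have := flip (y - x); lra.
have cS k : closed_convex (S k).
  split.
  - have /andP[w0 _] := w01 k.
    by have [z [Pz fz]] := mlt _ w0; exists z; split=> //; exact: ltW.
  - apply/closed_enormP => x h; split.
      by apply: cP => e /h[y [[Py _] yx]]; exists y.
    apply: fcont => e e0; have [y [[_ fy] yx]] := h _ e0.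
    by exists y; split=> //; rewrite (le_lt_trans fy)// ltrDl.
  - move=> x y t t01 [Px fx] [Py fy]; have /andP[t0 t1] := t01.
    have t2 : 0 <= 1 - t by lra.
    split.
      move=> i; rewrite dotpDr !dotpZr.
      by have := Px i; have := Py i; nra.
    rewrite linearD !linearZ/= (le_trans (enormD _ _))//.
    rewrite !enormZ !ger0_norm//; nra.
pose z k := proj (S k) 0.
have zS k : S k (z k) by exact: proj_in.
have zmin k y : S k y -> enorm (z k) <= enorm y.
  move=> Sy; have [_ /(_ _ Sy)] := proj_min 0 (cS k).
  by rewrite !sub0r !enormN.
(* If the norms of the [z k] fall below some [M] infinitely often, a cluster point of those [z k] is
   a minimizer. *)
have [[M zM]|zoo] := pselect (exists M : R, forall K, exists k, (K <= k)%N /\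
    enorm (z k) <= M).
  have [g gP] := choice zM.
  have [p clp] := enorm_cluster (x := z \o g) (fun K => proj2 (gP K)).
  have Pp : P p.
    apply: cP => e e0; have [K [_ ?]] := clp e e0 0%N.
    by exists (z (g K)); case: (zS (g K)).
  exists p; split=> // y /mle my; apply: le_trans my.
  apply: fcont => e e0; have [K0 HK] := wlt e e0.
  have [K [K0K ?]] := clp e e0 K0; exists (z (g K)); split=> //.
  have [_] := zS (g K); have := HK (g K) (leq_trans K0K (proj1 (gP K))); lra.
(* Otherwise the norms tend to infinity, and the normalized points [h k] cluster at a recession
   direction [p] of [P] annihilated by [f]. *)
exfalso; pose r k := enorm (z k); pose h k := (r k)^-1 *: z k.
have {}zoo (M : R) : exists K, forall k, (K <= k)%N -> M < r k.
  apply: contrapT => nK; apply: zoo; exists M => K; apply: contrapT => nk.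
  apply: nK; exists K => k Kk; rewrite ltNge; apply/negP => rM.
  by apply: nk; exists k.
have [p clp] : exists p : 'rV[R]_n, forall e : R, 0 < e ->
    forall n, exists m, (n <= m)%N /\ enorm (h m - p) < e.
  apply: (enorm_cluster (M := 1)) => k; rewrite enormZ ger0_norm ?invr_ge0 ?enorm_ge0//.
  have [->|r0] := eqVneq (r k) 0; first by rewrite invr0 mul0r.
  by rewrite mulVf.
have {}clp (e M : R) : 0 < e -> exists k, [/\ enorm (h k - p) < e, M < r k & 0 < r k].
  move=> e0; have [K HK] := zoo (Num.max M 0); have [k [/HK]] := clp e e0 K.
  by rewrite gt_max => /andP[? ?] ?; exists k.
have zE k : 0 < r k -> z k = r k *: h k.
  by move=> r0; rewrite scalerA divff ?scale1r// gt_eqF.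
have hh k : 0 < r k -> dotp (h k) (h k) = 1.
  by move=> r0; rewrite dotpZl dotpZr -sqr_enorm -/(r k) expr2; field; rewrite gt_eqF.
move: h clp zE hh => h clp zE hh.
have m0 : 0 <= m.
  apply: le_of_lt_addr => e /mlt[y [_]]; have := enorm_ge0 (f y); lra.
have fp : f p = 0.
  apply: enorm_le0; apply: fcont => e e0; rewrite add0r.
  have [k [kp kM r0]] := clp e ((m + 1) / e) e0; exists (h k); split=> //.
  have [_] := zS k; rewrite (zE k)// linearZ/= enormZ gtr0_norm// => fz.
  rewrite ltr_pdivrMr// in kM; have /andP[_ w1] := w01 k.
  rewrite -(ltr_pM2l r0); lra.
have up i : dotp (u i) p <= 0.
  apply: le_of_lt_addr => e e0; rewrite add0r.
  have u1 : 0 < enorm (u i) + 1 by rewrite ltr_wpDl ?enorm_ge0.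
  have e20 : 0 < e / 2 by lra.
  have [k [kp kM r0]] := clp _ (`|c i| / (e / 2)) (divr_gt0 e20 u1).
  rewrite ltr_pdivrMr// in kM; rewrite ltr_pdivlMr// in kp.
  have [/(_ i) + _] := zS k; rewrite (zE k)// dotpZr => uc.
  have ue : dotp (u i) (h k) < e / 2.
    by rewrite -(ltr_pM2l r0) (le_lt_trans uc)// (le_lt_trans (ler_norm _)).
  have -> : dotp (u i) p = dotp (u i) (h k) - dotp (u i) (h k - p).
    by rewrite !dotpE; ring.
  have := dotp_abs_le (u i) (h k - p); rewrite ler_norml => /andP[+ _].
  have := enorm_ge0 (h k - p); lra.
(* Late [z k] stay admissible after subtracting [p]: if [dotp (u i) p] is not negative, the left
   side does not grow; otherwise [dotp (u i) (z k)] becomes arbitrarily negative as [r k] grows. *)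
pose Q i e := forall k, 0 < r k -> e^-1 < r k -> enorm (h k - p) < e ->
  dotp (u i) (z k - p) <= c i.
have [i e e' ee' Qe' k r0 ek kp||e [e0 Qe]] := finite_threshold (Q := Q).
- have e0 : 0 < e by rewrite (le_lt_trans _ kp)// enorm_ge0.
  apply: Qe' => //; last by rewrite (lt_le_trans kp).
  by rewrite (le_lt_trans _ ek)// lef_pV2 // posrE// (lt_le_trans e0).
- move=> i; have [up0|up0] := leP 0 (dotp (u i) p).
    exists 1; split=> // k r0 _ _; have [/(_ i) + _] := zS k.
    by rewrite !dotpE; lra.
  set t := dotp (u i) p in up0.
  have u1 : 0 < enorm (u i) + 1 by rewrite ltr_wpDl ?enorm_ge0.
  (* Beyond this bound, [r k * (t / 2)] lies below [c i + t]. *)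
  have c0 : 0 < 2 + 2 * `|c i| / - t.
    by rewrite ltr_pwDl// divr_ge0 ?mulr_ge0//; lra.
  exists (Num.min ((2 + 2 * `|c i| / - t)^-1) (- t / 2 / (enorm (u i) + 1))).
  split; first by rewrite lt_min invr_gt0 c0 !divr_gt0// oppr_gt0.
  move=> k r0; rewrite lt_min => kM /andP[_]; rewrite ltr_pdivlMr// => kp.
  have {kM} : 2 + 2 * `|c i| / - t < r k.
    rewrite (le_lt_trans _ kM)// -[leLHS]invrK lef_pV2 ?posrE ?invr_gt0//.
      by rewrite ge_min lexx.
    by rewrite lt_min invr_gt0 c0 !divr_gt0// oppr_gt0.
  rewrite -ltrBrDl ltr_pdivrMr ?oppr_gt0// => kM.
  have uh : dotp (u i) (h k) <= t / 2.
    have -> : dotp (u i) (h k) = t + dotp (u i) (h k - p) by rewrite !dotpE /t; ring.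
    have := dotp_le (u i) (h k - p); have := enorm_ge0 (h k - p); lra.
  rewrite (zE k)// !dotpE -/t; have := ler_norm (- c i); rewrite normrN => cn.
  have : r k * dotp (u i) (h k) <= r k * (t / 2) by rewrite ler_pM2l.
  lra.
(* A distance below 1/2 from the unit vector [h k] gives [dotp (h k) p > 1/2] and [dotp p p < 9/4].
   With [r k > 9/4] this makes [z k - p] shorter than [z k]. *)
have emin : 0 < Num.min e 2^-1 by rewrite lt_min e0 invr_gt0 ltr0n.
have [k [kp]] := clp _ (Num.max e^-1 (9 / 4)) emin.
move: kp; rewrite lt_min gt_max => /andP[ke k2] /andP[kM k9] r0.
have /zmin : S k (z k - p).
  have [_ fz] := zS k; split; first by move=> i; exact: Qe.
  by rewrite linearB fp subr0.
rewrite le_enorm !dotpE (dotpC p) (zE k)// !dotpZl !dotpZr hh// => le1.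
have hp1 := hh k r0.
have : dotp (h k - p) (h k - p) < 2^-1 ^+ 2 by rewrite -enorm_lt// invr_ge0.
rewrite !dotpE (dotpC p) hp1.
have := dotp_abs_le (h k) (h k - p); rewrite ler_norml !dotpE hp1 => /andP[_].
have : enorm (h k) = 1.
  by apply/eqP; rewrite -(eqrXn2 (n := 2)) ?enorm_ge0// sqr_enorm hp1 expr1n.
move=> ->; nra.
Qed.

Lemma dotp_row_mx (R : realType) (m n : nat) (x1 y1 : 'rV[R]_m)
    (x2 y2 : 'rV[R]_n) :
  dotp (row_mx x1 x2) (row_mx y1 y2) = dotp x1 y1 + dotp x2 y2.
Proof.
rewrite /dotp big_split_ord; congr (_ + _); apply: eq_bigr => i _.
  by rewrite !row_mxEl.
by rewrite !row_mxEr.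
Qed.

(** A pair is read as one vector of length [d + d]: the product of the polyhedra is a polyhedron,
    and the distance is the norm of a linear map. For general closed convex sets it need not be
    attained. *)
Lemma best_approx_pair_exists (R : realType) (d N : nat)
    (A B : nat -> set 'rV[R]_d) :
  (forall i, (1 <= i <= N)%N -> halfspace_or_full (A i)) ->
  (forall j, (1 <= j <= N)%N -> halfspace_or_full (B j)) ->
  polyhedron N A !=set0 -> polyhedron N B !=set0 ->
  exists a b, best_approx_pair (polyhedron N A) (polyhedron N B) a b.
Proof.
move=> hA hB [a0 Aa0] [b0 Bb0].
have iN (i : 'I_N) : (1 <= i.+1 <= N)%N by rewrite ltn_ord.
have repr (C : nat -> set 'rV[R]_d) :
    (forall i, (1 <= i <= N)%N -> halfspace_or_full (C i)) ->
    exists (u : 'I_N -> 'rV[R]_d) (c : 'I_N -> R),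
      polyhedron N C = [set x | forall i, dotp (u i) x <= c i].
  move=> hC; have /choice[uc ucP] (i : 'I_N) :
      exists uc : 'rV[R]_d * R, C i.+1 = [set x | dotp uc.1 x <= uc.2].
    have [_ [u [c [-> _]]]] := halfspace_or_fullP (hC _ (iN i)).
    by exists (u, c).
  exists (fst \o uc), (snd \o uc); apply/seteqP; split=> x Cx.
    by move=> i; have := Cx _ (iN i); rewrite ucP.
  case=> // i /= iN'; have := Cx (Ordinal iN').
  by rewrite -/([set x | dotp (uc (Ordinal iN')).1 x <= _] x) -ucP.
have [uA [cA AE]] := repr _ hA; have [uB [cB BE]] := repr _ hB.
pose u (i : 'I_N + 'I_N) : 'rV[R]_(d + d) := match i with
  inl i => row_mx (uA i) 0 | inr i => row_mx 0 (uB i) end.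
pose c (i : 'I_N + 'I_N) := match i with inl i => cA i | inr i => cB i end.
have uE i x y : dotp (u i) (row_mx x y) =
    match i with inl i => dotp (uA i) x | inr i => dotp (uB i) y end.
  by case: i => i; rewrite dotp_row_mx dotp0l ?addr0 ?add0r.
have sE x y : enorm (row_mx x y : 'rV[R]_(d + d)) ^+ 2 =
    enorm x ^+ 2 + enorm y ^+ 2 by rewrite !sqr_enorm dotp_row_mx.
have [z||z [Pz zmin]] := @polyhedron_linear_min R (d + d) d _ u c
    (@lsubmx R 1 d d \- @rsubmx R 1 d d) 2.
- rewrite -[z]hsubmxK /= row_mxKl row_mxKr.
  set x := lsubmx z; set y := rsubmx z; set r := row_mx x y.
  have r0 := enorm_ge0 r; have xyr := sE x y; rewrite -/r in xyr.
  have xr : enorm x <= enorm r.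
    by rewrite -ler_sqr ?nnegrE ?enorm_ge0// xyr lerDl sqr_ge0.
  have yr : enorm y <= enorm r.
    by rewrite -ler_sqr ?nnegrE ?enorm_ge0// xyr lerDr sqr_ge0.
  by have := enormB_le x y; lra.
- exists (row_mx a0 b0) => i; rewrite uE; case: i => i.
    by move: Aa0; rewrite AE; apply.
  by move: Bb0; rewrite BE; apply.
exists (lsubmx z), (rsubmx z).
rewrite -[z]hsubmxK in Pz; split=> [||x y].
- by rewrite AE => i; have := Pz (inl i); rewrite uE.
- by rewrite BE => i; have := Pz (inr i); rewrite uE.
rewrite AE BE => Ax By; have := zmin (row_mx x y); rewrite /= row_mxKl row_mxKr.
by apply=> -[] i; rewrite uE; [apply: Ax|apply: By].
Qed.

(** * Convergence of the HLWB iteration *)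

Section RealSequences.
Variable R : realType.
Implicit Types (f l s t : nat -> R).

(** Past an index where the partial sum is within [e] of the supremum, further terms add at most
    [e]. *)
Lemma nonneg_tail f n0 (S : R) :
  (forall n, (n0 <= n)%N -> 0 <= f n) ->
  (forall n, \sum_(n0 <= i < n) f i <= S) ->
  forall e : R, 0 < e -> exists K, (n0 <= K)%N /\
    forall k n, (K <= k)%N -> \sum_(k <= i < n) f i <= e.
Proof.
move=> f0 fS e e0.
have tail0 k n : (n0 <= k)%N -> 0 <= \sum_(k <= i < n) f i.
  move=> n0k; rewrite big_nat_cond sumr_ge0// => i /andP[/andP[ki _] _].
  by rewrite f0// (leq_trans n0k).
pose E := range (fun n => \sum_(n0 <= i < n) f i).
have supE : has_sup E.
  by split; [exists (\sum_(n0 <= i < 0) f i), 0%N|exists S => _ [n _ <-]].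
have [_ [n _ <-] nE] := sup_adherent e0 supE.
exists (maxn n0 n); split=> [|k m]; first exact: leq_maxl.
rewrite geq_max => /andP[n0k nk].
have [mk|/ltnW km] := leqP m k; first by rewrite big_geq// ltW.
have : \sum_(n0 <= i < m) f i <= sup E by apply: sup_ubound; [case: supE|exists m].
rewrite (@big_cat_nat _ _ _ k)//=.
have [nn0|/ltnW n0n] := leqP n n0.
  rewrite (@big_geq _ _ _ n0 n)// in nE.
  by have := tail0 n0 k (leqnn _); lra.
rewrite (@big_cat_nat _ _ _ n n0 k)//=.
by have := tail0 n k n0n; lra.
Qed.

Lemma prod1B_ge0 l m n :
  (forall i, (m <= i)%N -> 0 <= l i <= 1) -> 0 <= \prod_(m <= i < n) (1 - l i).
Proof.
move=> l01; rewrite big_nat_cond prodr_ge0// => i /andP[/andP[mi _] _].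
by rewrite subr_ge0; case/andP: (l01 _ mi).
Qed.

Lemma prod1B_le1 l m n :
  (forall i, (m <= i)%N -> 0 <= l i <= 1) -> \prod_(m <= i < n) (1 - l i) <= 1.
Proof.
move=> l01; rewrite big_nat_cond prodr_ile1// => i /andP[/andP[mi _] _].
by have /andP[? ?] := l01 _ mi; rewrite subr_ge0 gerBl; apply/andP.
Qed.

(** Elementary substitute for the exponential bound, by induction from
    [(1 - l) * (1 + S + l) <= 1 + S]. It makes the product vanish when the sum diverges. *)
Lemma prod1B_sum_le l m n : (forall i, (m <= i)%N -> 0 <= l i <= 1) ->
  \prod_(m <= i < n) (1 - l i) * (1 + \sum_(m <= i < n) l i) <= 1.
Proof.
move=> l01; elim: n => [|n IH]; first by rewrite !big_geq// addr0 mulr1.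
have [nm|mn] := ltnP n m; first by rewrite !big_geq// addr0 mulr1.
rewrite !big_nat_recr//=; have /andP[l0 l1] := l01 _ mn.
have S0 : 0 <= \sum_(m <= i < n) l i.
  rewrite big_nat_cond sumr_ge0// => i /andP[/andP[mi _] _].
  by case/andP: (l01 _ mi).
have P0 := @prod1B_ge0 l m n l01.
apply: le_trans IH; rewrite -mulrA ler_wpM2l//.
by have := mulr_ge0 l0 S0; nra.
Qed.

Lemma prod1B_vanish l m : (forall i, (m <= i)%N -> 0 <= l i <= 1) ->
  (forall M : R, exists n, M <= \sum_(m <= i < n) l i) ->
  forall e : R, 0 < e -> exists K, forall n, (K <= n)%N ->
    \prod_(m <= i < n) (1 - l i) <= e.
Proof.
move=> l01 loo e e0; have [K lK] := loo e^-1.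
have PK := @prod1B_sum_le l m K l01; have P0 := @prod1B_ge0 l m K l01.
have PKe : \prod_(m <= i < K) (1 - l i) <= e.
  have e1 : 0 < e^-1 by rewrite invr_gt0.
  rewrite -(ler_pM2r e1) divff ?gt_eqF// (le_trans _ PK)// ler_wpM2l//; lra.
have mK : (m <= K)%N.
  rewrite leqNgt; apply/negP => Km; rewrite big_geq ?(ltnW Km)// in lK.
  have : 0 < e^-1 by rewrite invr_gt0.
  by lra.
exists K => n Kn; rewrite (@big_cat_nat _ _ _ K)//= (le_trans _ PKe)//.
rewrite ler_piMr// prod1B_le1// => i Ki; apply: l01; exact: leq_trans Ki.
Qed.

(* Xu's lemma *)
Lemma recursion_vanish l s t f m : (forall i, (m <= i)%N -> 0 <= l i <= 1) ->
  (forall k M, (m <= k)%N -> exists n, M <= \sum_(k <= i < n) l i) ->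
  (forall i, (m <= i)%N -> 0 <= f i) ->
  (exists S : R, forall n, \sum_(m <= i < n) f i <= S) ->
  (forall e : R, 0 < e -> exists K, forall n, (K <= n)%N -> t n <= e) ->
  (forall n, (m <= n)%N ->
    s n.+1 <= (1 - l n.+1) * s n + l n.+1 * t n.+1 + f n.+1) ->
  forall e : R, 0 < e -> exists K, forall n, (K <= n)%N -> s n <= e.
Proof.
move=> l01 loo f0 [S fS] tto0 srec e e0.
have e3 : 0 < e / 3 by lra.
have [K1 tK] := tto0 _ e3.
have [K2 [mK2 fK]] := nonneg_tail f0 fS e3.
set K := maxn K1 K2; have K1K : (K1 <= K)%N := leq_maxl _ _.
have K2K : (K2 <= K)%N := leq_maxr _ _; have mK := leq_trans mK2 K2K.
have l01' i : (K.+1 <= i)%N -> 0 <= l i <= 1.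
  by move=> /ltnW Ki; apply: l01; exact: leq_trans Ki.
pose a := `|s K| + 1; have a0 : 0 < a by rewrite ltr_wpDl.
(* Unrolled from [K]: the initial value is damped by the product, the [t] terms enter as convex
   combinations and stay below [e / 3], the [f] terms add up. *)
have bound n : (K <= n)%N -> s n <= \prod_(K.+1 <= i < n.+1) (1 - l i) * a +
    e / 3 + \sum_(K.+1 <= i < n.+1) f i.
  elim: n => [|n IH]; rewrite leq_eqVlt => /predU1P[KE|Kn].
  - by rewrite KE !big_geq// mul1r; have := ler_norm (s 0); rewrite /a KE; lra.
  - by [].
  - by rewrite -KE !big_geq// mul1r; have := ler_norm (s K); rewrite /a; lra.
  have mn : (m <= n)%N := leq_trans mK Kn.
  have := srec _ mn; have := IH Kn; rewrite [in X in _ -> _ -> X]big_nat_recr//.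
  rewrite [in X in _ -> _ -> X](@big_nat_recr _ _ _ n.+1)//=.
  have /andP[l0 l1] := l01 n.+1 (leqW mn).
  have tn := tK n.+1 (leq_trans K1K (leqW Kn)).
  have S0 : 0 <= \sum_(K.+1 <= i < n.+1) f i.
    rewrite big_nat_cond sumr_ge0// => i /andP[/andP[Ki _] _].
    by rewrite f0// (leq_trans mK)// ltnW.
  set P := \prod_(_ <= i < _) _; set F := \sum_(_ <= i < _) _ in S0 *.
  move=> IH' /le_trans; apply.
  have h1 : (1 - l n.+1) * s n <= (1 - l n.+1) * (P * a + e / 3 + F).
    by rewrite ler_wpM2l// subr_ge0.
  have h2 : l n.+1 * t n.+1 <= l n.+1 * (e / 3) by rewrite ler_wpM2l.
  have h3 := mulr_ge0 l0 S0; lra.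
have [K3 PK3] := prod1B_vanish l01' (fun M => loo K.+1 M (leqW mK)) (divr_gt0 e3 a0).
exists (maxn K K3) => n; rewrite geq_max => /andP[Kn K3n].
have := bound n Kn; have := fK K.+1 n.+1 (leqW K2K).
by have := PK3 n.+1 (leqW K3n); rewrite ler_pdivlMr//; lra.
Qed.

End RealSequences.

Lemma mod1_bounds N n : (0 < N)%N -> (1 <= mod1 N n <= N)%N.
Proof. by move=> N0; rewrite /mod1 /= ltn_mod. Qed.

Lemma mod1D N n : mod1 N (n + N).+1 = mod1 N n.+1.
Proof. by rewrite /mod1 /= modnDr. Qed.

(** Every window of [N] consecutive steps visits each set. The offset is the residue of [i - 1 - n]
    modulo [N], written so as to avoid truncated subtraction. *)
Lemma mod1_hit N n i : (1 <= i <= N)%N ->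
  exists j, (j < N)%N /\ mod1 N (n + j).+1 = i.
Proof.
case: i => // i /= iN; have N0 : (0 < N)%N by apply: leq_ltn_trans iN.
exists ((i + (N - n %% N)) %% N)%N; rewrite ltn_mod; split=> //.
have nN := ltn_pmod n N0.
by rewrite /mod1 /= modnDmr -modnDml addnCA subnKC ?(ltnW nN)// modnDr modn_small.
Qed.

Section HLWB.
Variables (R : realType) (d N : nat) (lam : nat -> R) (n0 : nat).
Implicit Types (C : nat -> set 'rV[R]_d) (b x z q : 'rV[R]_d).
Hypothesis N0 : (0 < N)%N.
Hypothesis lam01 : forall n, (n0 <= n)%N -> 0 <= lam n <= 1.

(** Each step gives the anchors the weight [lam] and multiplies the memory of the starting points by
    [1 - lam]. The recursions are assumed on a range of indices only, because an orbit of a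
    localized system will follow [T] only there. *)
Lemma recursion_contract (T : nat -> 'rV[R]_d -> 'rV[R]_d) b b'
    (z z' : nat -> 'rV[R]_d) m n :
  (forall i x y, enorm (T i x - T i y) <= enorm (x - y)) ->
  (n0 <= m)%N -> (m <= n)%N ->
  (forall i, (m <= i < n)%N ->
    z i.+1 = lam i.+1 *: b + (1 - lam i.+1) *: T i (z i)) ->
  (forall i, (m <= i < n)%N ->
    z' i.+1 = lam i.+1 *: b' + (1 - lam i.+1) *: T i (z' i)) ->
  enorm (z n - z' n) <=
    (1 - \prod_(m.+1 <= i < n.+1) (1 - lam i)) * enorm (b - b') +
    \prod_(m.+1 <= i < n.+1) (1 - lam i) * enorm (z m - z' m).
Proof.
move=> T1 n0m; elim: n => [|n IH]; rewrite leq_eqVlt => /predU1P[->|mn] zE zE'.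
- by rewrite !big_geq// subrr mul0r mul1r add0r.
- by [].
- by rewrite !big_geq// subrr mul0r mul1r add0r.
rewrite big_nat_recr//= zE ?leqnn ?andbT// zE' ?leqnn ?andbT//.
have {}IH : enorm (z n - z' n) <=
    (1 - \prod_(m.+1 <= i < n.+1) (1 - lam i)) * enorm (b - b') +
    \prod_(m.+1 <= i < n.+1) (1 - lam i) * enorm (z m - z' m).
  by apply: (IH mn) => [i|i] /andP[mi iin]; [apply: zE|apply: zE']; rewrite mi ltnW.
have n0n : (n0 <= n.+1)%N by rewrite (leq_trans n0m)// ltnW.
have l01 := lam01 n0n; have /andP[l0 l1] := l01.
have -> : lam n.+1 *: b + (1 - lam n.+1) *: T n (z n) -
    (lam n.+1 *: b' + (1 - lam n.+1) *: T n (z' n)) =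
    lam n.+1 *: (b - b') + (1 - lam n.+1) *: (T n (z n) - T n (z' n)).
  by apply/rowP => i; rewrite !mxE; ring.
apply: (le_trans (enorm_convex _ _ l01)).
have l2 : 0 <= 1 - lam n.+1 by rewrite subr_ge0.
have := ler_wpM2l l2 (le_trans (T1 n (z n) (z' n)) IH); lra.
Qed.

End HLWB.

Section HLWB.
Variables (R : realType) (d N : nat) (lam : nat -> R) (n0 : nat).
Implicit Types (C : nat -> set 'rV[R]_d) (b x z q : 'rV[R]_d).
Hypothesis N0 : (0 < N)%N.
Hypothesis lam01 : forall n, (n0 <= n)%N -> 0 <= lam n <= 1.

(** The finitely many steps before [n0], where [lam] may leave [[0, 1]], cost a constant factor;
    later ones are convex combinations of nonexpansive maps. So [L] depends neither on [n] nor on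
    the family. *)
Lemma hlwb_lipschitz : exists L : R, 1 <= L /\
  forall C, (forall i, (1 <= i <= N)%N -> closed_convex (C i)) ->
  forall n b b' x x', enorm (hlwb N lam C n b x - hlwb N lam C n b' x') <=
    L * (enorm (b - b') + enorm (x - x')).
Proof.
have pre k : exists L : R, 1 <= L /\
    forall C, (forall i, (1 <= i <= N)%N -> closed_convex (C i)) ->
    forall n b b' x x', (n <= k)%N ->
    enorm (hlwb N lam C n b x - hlwb N lam C n b' x') <=
      L * (enorm (b - b') + enorm (x - x')).
  elim: k => [|k [L [L1 IH]]].
    exists 1; split=> // C _ [|//] b b' x x' _ /=.
    by rewrite mul1r lerDr enorm_ge0.
  have l0 := normr_ge0 (lam k.+1); have l0' := normr_ge0 (1 - lam k.+1).
  exists (L + `|lam k.+1| + `|1 - lam k.+1| * L); split.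
    have := mulr_ge0 l0' (le_trans ler01 L1); lra.
  move=> C cC n b b' x x'.
  have bb := enorm_ge0 (b - b'); have xx := enorm_ge0 (x - x').
  have D0 : 0 <= enorm (b - b') + enorm (x - x') by lra.
  have M0 := mulr_ge0 l0' (mulr_ge0 (le_trans ler01 L1) D0).
  have M1 := mulr_ge0 l0 bb; have M2 := mulr_ge0 l0 xx.
  rewrite leq_eqVlt => /predU1P[->|nk]; last first.
    have := IH C cC n b b' x x' nk; lra.
  rewrite /=; set p := proj _ _; set p' := proj _ (hlwb _ _ _ _ b' x').
  have -> : lam k.+1 *: b + (1 - lam k.+1) *: p -
      (lam k.+1 *: b' + (1 - lam k.+1) *: p') =
      lam k.+1 *: (b - b') + (1 - lam k.+1) *: (p - p').
    by apply/rowP => i; rewrite !mxE; ring.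
  rewrite (le_trans (enormD _ _))// !enormZ.
  have pp := le_trans (proj_nonexp _ _ (cC _ (mod1_bounds k.+1 N0)))
    (IH C cC k b b' x x' (leqnn _)).
  have := ler_wpM2l l0' pp; rewrite -/p -/p'.
  have := mulr_ge0 (le_trans ler01 L1) D0; lra.
have [L [L1 HL]] := pre n0; exists L; split=> // C cC n b b' x x'.
have [nn0|/ltnW n0n] := leqP n n0; first exact: HL.
have := recursion_contract (T := fun i => proj (C (mod1 N i.+1)))
  (z := fun n => hlwb N lam C n b x) (z' := fun n => hlwb N lam C n b' x')
  lam01 (fun i x y => proj_nonexp x y (cC _ (mod1_bounds i.+1 N0)))
  (leqnn n0) n0n (fun i _ => erefl) (fun i _ => erefl).
move=> /le_trans; apply.
have l01' i : (n0.+1 <= i)%N -> 0 <= lam i <= 1 by move=> /ltnW; exact: lam01.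
have := prod1B_ge0 n.+1 l01'; have := prod1B_le1 n.+1 l01'.
set P := \prod_(_ <= i < _) _ => P1 P0.
have := ler_wpM2l P0 (HL C cC n0 b b' x x' (leqnn _)).
have bb := enorm_ge0 (b - b'); have xx := enorm_ge0 (x - x').
have P1' : 0 <= 1 - P by lra.
have : (1 - P) * enorm (b - b') <= (1 - P) * (L * (enorm (b - b') + enorm (x - x'))).
  by rewrite ler_wpM2l//; nra.
lra.
Qed.

Lemma hlwb_fixed C q n : (forall i, (1 <= i <= N)%N -> closed_convex (C i)) ->
  polyhedron N C q -> hlwb N lam C n q q = q.
Proof.
move=> cC Cq; elim: n => //= n ->.
have iN := mod1_bounds n.+1 N0.
by rewrite (proj_id (cC _ iN) (Cq _ iN)) -scalerDl addrC subrK scale1r.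
Qed.

Section Convergence.
Variable C : nat -> set 'rV[R]_d.
Hypothesis cC : forall i, (1 <= i <= N)%N -> closed_convex (C i).
Hypothesis C0 : polyhedron N C !=set0.
Hypothesis lam0 : forall e : R, 0 < e ->
  exists K, forall n, (K <= n)%N -> lam n <= e.
Hypothesis lamoo : forall m (M : R), exists n, M <= \sum_(m <= i < n) lam i.
Hypothesis lamN : exists S : R, forall n,
  \sum_(1 <= i < n) `|lam i - lam (i + N)%N| <= S.

Let cP := polyhedron_closed_convex cC C0.

Section Orbit.
Variables b x : 'rV[R]_d.
Let z n := hlwb N lam C n b x.
Let w n := proj (C (mod1 N n.+1)) (z n).

Lemma hlwb_orbit_bounded q : polyhedron N C q -> exists r, [/\ 1 <= r,
  forall n, enorm (z n - q) <= r, forall n, enorm (w n - q) <= r &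
  forall n, enorm (b - w n) <= r].
Proof.
move=> Cq; have [L [L1 HL]] := hlwb_lipschitz.
set D := enorm (b - q) + enorm (x - q).
have bq := enorm_ge0 (b - q); have xq := enorm_ge0 (x - q).
have LD : 0 <= L * D by rewrite mulr_ge0//; rewrite /D; lra.
have zq n : enorm (z n - q) <= L * D.
  by have := HL C cC n b q x q; rewrite (hlwb_fixed _ cC Cq).
have wq n : enorm (w n - q) <= L * D.
  have iN := mod1_bounds n.+1 N0; apply: le_trans (zq n).
  by rewrite -[X in w n - X](proj_id (cC iN) (Cq _ iN)) (proj_nonexp _ _ (cC iN)).
exists (L * D + enorm (b - q) + 1); split=> [|n|n|n]; first lra.
- by have := zq n; lra.
- by have := wq n; lra.
by have := wq n; have := enorm_triangle q b (w n); rewrite (enormC q); lra.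
Qed.

(** Steps [n] and [n + N] use the same projection, so the difference contracts by [1 - lam] up to an
    error proportional to [|lam n - lam (n + N)|]. These errors are summable, and Xu's lemma
    applies. *)
Lemma hlwb_period_vanish : forall e : R, 0 < e ->
  exists K, forall n, (K <= n)%N -> enorm (z (n + N) - z n) <= e.
Proof.
have [q Cq] := C0; have [r [r1 zr wr br]] := hlwb_orbit_bounded Cq.
have [S lamS] := lamN.
apply: (recursion_vanish (l := lam) (t := fun=> 0) (m := n0.+1)
  (f := fun n => `|lam n - lam (n + N)%N| * r)).
- by move=> i /ltnW; exact: lam01.
- by move=> k M _; exact: lamoo.
- by move=> i _; rewrite mulr_ge0//; lra.
- exists (S * r) => n; rewrite -mulr_suml ler_wpM2r//; first lra.
  apply: le_trans (lamS n); have [nn0|n0n] := leqP n n0.+1.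
    by rewrite big_geq// big_nat_cond sumr_ge0.
  rewrite [leRHS](@big_cat_nat _ _ _ n0.+1) ?(ltnW n0n)//=.
  by rewrite lerDr big_nat_cond sumr_ge0.
- by move=> e e0; exists 0%N => n _; exact: ltW.
move=> n n0n; have n0n' : (n0 <= n.+1)%N by rewrite ltnW// ltnW.
have /andP[l0 l1] := lam01 n0n'.
have zS k : z k.+1 = lam k.+1 *: b + (1 - lam k.+1) *: w k by [].
rewrite addSn !zS mulr0 addr0.
set l := lam n.+1 in l0 l1 *; set l' := lam (n + N).+1.
have -> : l' *: b + (1 - l') *: w (n + N) - (l *: b + (1 - l) *: w n) =
    (1 - l) *: (w (n + N) - w n) + (l' - l) *: (b - w (n + N)).
  by apply/rowP => i; rewrite !mxE; ring.
rewrite (le_trans (enormD _ _))// !enormZ ger0_norm ?subr_ge0// distrC.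
rewrite lerD ?ler_wpM2l ?subr_ge0//.
by rewrite /w mod1D proj_nonexp//; exact/cC/mod1_bounds.
Qed.

(** Each projection lowers the squared distance to a feasible [q] by the squared residual. Over one
    period that distance hardly changes, because [z (n + N)] is close to [z n]; so the residual is
    small. *)
Lemma hlwb_residual_vanish : forall e : R, 0 < e ->
  exists K, forall n, (K <= n)%N -> enorm (z n - w n) <= e.
Proof.
have [q Cq] := C0; have [r [r1 zr wr br]] := hlwb_orbit_bounded Cq.
(* The move towards the anchor adds at most [3 * r ^+ 2 * lam n.+1] to the squared distance, as
   [w n - q] and [b - w n] are bounded by [r] and [lam n.+1 <= 1]. *)
have step n (c : R) : (n0 <= n.+1)%N -> lam n.+1 <= c ->
    dotp (z n - w n) (z n - w n) <=
    enorm (z n - q) ^+ 2 - enorm (z n.+1 - q) ^+ 2 + 3 * r ^+ 2 * c.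
  move=> n0n lc; have iN := mod1_bounds n.+1 N0.
  have /andP[l0 l1] := lam01 n0n.
  have := proj_fejer (z n) (cC iN) (Cq _ iN); rewrite -/(w n) -!sqr_enorm.
  have : enorm (z n.+1 - q) <= enorm (w n - q) + lam n.+1 * r.
    have -> : z n.+1 - q = (w n - q) + lam n.+1 *: (b - w n).
      by apply/rowP => i; rewrite !mxE; ring.
    rewrite (le_trans (enormD _ _))// enormZ ger0_norm// lerD2l ler_wpM2l//.
  have := wr n; have := enorm_ge0 (w n - q); have := enorm_ge0 (z n.+1 - q).
  set u := enorm (w n - q); set v := enorm (z n.+1 - q) => v0 u0 ur uv.
  set l := lam n.+1 in lc l0 l1 uv.
  have lr : 0 <= l * r by rewrite mulr_ge0//; lra.
  have : v ^+ 2 <= (u + l * r) ^+ 2 by rewrite ler_sqr// nnegrE// addr_ge0.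
  have : (u + l * r) ^+ 2 <= u ^+ 2 + 3 * r ^+ 2 * l.
    have : l * r * u <= l * r * r by rewrite ler_wpM2l.
    have : l * r * (l * r) <= l * r * (1 * r).
      rewrite ler_wpM2l// ler_wpM2r//; lra.
    by rewrite !expr2; lra.
  have : 3 * r ^+ 2 * l <= 3 * r ^+ 2 * c by rewrite ler_wpM2l// mulr_ge0// sqr_ge0.
  by lra.
have steps n (c : R) j : (n0 <= n.+1)%N -> 0 <= c ->
    (forall i, (n <= i)%N -> lam i <= c) ->
    dotp (z n - w n) (z n - w n) <=
    enorm (z n - q) ^+ 2 - enorm (z (n + j).+1 - q) ^+ 2 + 3 * r ^+ 2 * c * j.+1%:R.
  move=> n0n c0 lc; elim: j => [|j IH].
    by rewrite addn0 mulr1; apply: step => //; exact: lc.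
  have nj : (n.+1 <= (n + j).+2)%N by rewrite ltnS leqW// leq_addr.
  have := step _ c (leq_trans n0n nj) (lc _ (ltnW nj)); rewrite addnS.
  have := dotp_ge0 (z (n + j).+1 - w (n + j).+1).
  by rewrite -[in j.+2%:R]addn1 natrD; lra.
move=> e e0.
have r0 : 0 < r by lra.
have r2 : 0 < r ^+ 2 by rewrite exprn_gt0.
(* The anchor terms of one period then sum to [e ^+ 2 / 2]; the drop of the squared distance gets
   the other half. *)
pose c := e ^+ 2 / 2 / (3 * r ^+ 2 * N%:R).
have e2 : 0 < e ^+ 2 by rewrite exprn_gt0.
have NR : 0 < 3 * r ^+ 2 * N%:R by rewrite mulr_gt0 ?ltr0n// mulr_gt0.
have c0 : 0 < c by rewrite !divr_gt0.
have [K1 lK] := lam0 c0.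
have [K2 zK] := hlwb_period_vanish (divr_gt0 e2 (mulr_gt0 (ltr0n _ 4) r0)).
exists (maxn n0 (maxn K1 K2)) => n; rewrite !geq_max => /and3P[n0n K1n K2n].
rewrite (enorm_le _ (ltW e0)).
have := steps n c N.-1 (leqW n0n) (ltW c0) (fun i ni => lK i (leq_trans K1n ni)).
rewrite -addnS prednK// => /le_trans; apply.
have -> : 3 * r ^+ 2 * c * N%:R = e ^+ 2 / 2.
  by rewrite /c; field; rewrite !gt_eqF ?ltr0n//; lra.
have := zK n K2n; rewrite ler_pdivlMr ?mulr_gt0//.
have := zr n; have := zr (n + N)%N; have := enorm_triangle (z (n + N)) (z n) q.
have := enorm_ge0 (z n - q); have := enorm_ge0 (z (n + N) - q).
rewrite (enormC (z n) (z (n + N))).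
set u := enorm (z n - q); set v := enorm (z (n + N) - q).
set s := enorm _ => v0 u0 uvs vr ur sr.
have s0 : 0 <= s by exact: enorm_ge0.
have : (u - v) * (u + v) <= s * (r + r).
  have : (u - v) * (u + v) <= s * (u + v) by rewrite ler_wpM2r//; lra.
  have : s * (u + v) <= s * (r + r) by rewrite ler_wpM2l//; lra.
  lra.
by rewrite !expr2; lra.
Qed.

Lemma hlwb_increment_vanish j : forall e : R, 0 < e ->
  exists K, forall n, (K <= n)%N -> enorm (z (n + j) - z n) <= e.
Proof.
have [q Cq] := C0; have [r [r1 zr wr br]] := hlwb_orbit_bounded Cq.
elim: j => [|j IH] e e0; first by exists 0%N => n _; rewrite addn0 subrr enorm0 ltW.
have r0 : 0 < r by lra.
have e3 : 0 < e / 3 by lra.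
have [K1 zj] := IH _ e3.
have [K2 zw] := hlwb_residual_vanish e3.
have [K3 lK] := lam0 (divr_gt0 e3 r0).
exists (maxn (maxn n0 K1) (maxn K2 K3)) => n.
rewrite !geq_max => /andP[/andP[n0n K1n] /andP[K2n K3n]].
rewrite addnS; set m := (n + j)%N; have nm : (n <= m)%N by exact: leq_addr.
have := zj _ K1n; rewrite -/m.
have := zw m (leq_trans K2n nm).
have := lK m.+1 (leq_trans K3n (leqW nm)); rewrite ler_pdivlMr// => lr.
have /andP[l0 l1] := lam01 (leq_trans n0n (leqW nm)).
have : enorm (z m.+1 - w m) <= e / 3.
  have -> : z m.+1 - w m = lam m.+1 *: (b - w m).
    by apply/rowP => k; rewrite !mxE; ring.
  by rewrite enormZ ger0_norm// (le_trans _ lr)// ler_wpM2l.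
have := enorm_triangle (w m) (z m.+1) (z n).
have := enorm_triangle (z m) (w m) (z n).
by rewrite (enormC (w m) (z m)); lra.
Qed.

(** Within the next [N] steps the orbit is projected onto [C i] with a small residual; the vanishing
    increments carry this back to [z n]. *)
Lemma hlwb_feasible i : (1 <= i <= N)%N -> forall e : R, 0 < e ->
  exists K, forall n, (K <= n)%N -> enorm (z n - proj (C i) (z n)) <= e.
Proof.
move=> iN e e0; have e3 : 0 < e / 3 by lra.
have [K1 zw] := hlwb_residual_vanish e3.
have /choice[K2 zz] j := hlwb_increment_vanish j e3.
exists (maxn K1 (\max_(j < N) K2 j)) => n; rewrite geq_max => /andP[K1n K2n].
have [j [jN jE]] := mod1_hit n iN; pose m := (n + j)%N.
have := zz j n (leq_trans (leq_bigmax (Ordinal jN)) K2n); rewrite -/m.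
have := zw m (leq_trans K1n (leq_addr _ _)); rewrite /w jE.
have := proj_nonexp (z m) (z n) (cC iN).
have := enorm_triangle (z m) (z n) (proj (C i) (z n)).
have := enorm_triangle (proj (C i) (z m)) (z m) (proj (C i) (z n)).
rewrite (enormC (z n) (z m)); move: (z m) (z n) => x1 x2.
by move: (proj (C i) x1) (proj (C i) x2) => y1 y2; lra.
Qed.

Lemma hlwb_cluster_feasible (g : nat -> nat) p : (forall k, (k <= g k)%N) ->
  (forall e : R, 0 < e -> forall n, exists m,
    (n <= m)%N /\ enorm (z (g m) - p) < e) ->
  polyhedron N C p.
Proof.
move=> gk clp i iN; have [_ /closed_enormP clC _] := cC iN; apply: clC => e e0.
have e2 : 0 < e / 2 by lra.
have [K zK] := hlwb_feasible iN e2; have [m [Km zp]] := clp _ e2 K.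
exists (proj (C i) (z (g m))); split; first exact: (proj_in _ (cC iN)).
have := zK _ (leq_trans Km (gk m)).
have := enorm_triangle (z (g m)) (proj (C i) (z (g m))) p.
by rewrite (enormC (proj _ _) (z _)); lra.
Qed.

(** Otherwise a subsequence would cluster at a feasible point violating the variational inequality
    of the projection of [b]. *)
Lemma hlwb_dotp_limsup : forall e : R, 0 < e -> exists K, forall n, (K <= n)%N ->
  dotp (b - proj (polyhedron N C) b) (z n - proj (polyhedron N C) b) <= e.
Proof.
set p := proj _ _ => e e0; apply: contrapT => nK.
have /choice[g gP] K : exists n, (K <= n)%N /\ e < dotp (b - p) (z n - p).
  apply: contrapT => nn; apply: nK; exists K => n Kn.
  by rewrite leNgt; apply/negP => en; apply: nn; exists n.
have [q Cq] := C0; have [r [r1 zr wr br]] := hlwb_orbit_bounded Cq.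
have [|y cly] := enorm_cluster (x := z \o g) (M := r + enorm q).
  by move=> k /=; have := zr (g k); have := enormD (z (g k) - q) q; rewrite subrK; lra.
have Cy : polyhedron N C y.
  by apply: (hlwb_cluster_feasible (g := g)) => // k; case: (gP k).
have bp1 : 0 < enorm (b - p) + 1 by rewrite ltr_wpDl ?enorm_ge0.
have [m [_]] := cly _ (divr_gt0 e0 bp1) 0%N; rewrite ltr_pdivlMr//= => zy.
have [_] := gP m; apply/negP; rewrite -leNgt.
have -> : z (g m) - p = (y - p) + (z (g m) - y).
  by apply/rowP => k; rewrite !mxE; ring.
rewrite dotpDr; have := proj_var b cP Cy; rewrite -/p.
have := dotp_le (b - p) (z (g m) - y); have := enorm_ge0 (z (g m) - y); lra.
Qed.

(** Expanding a step bounds the new squared distance to [p] by [1 - lam] times the old one plus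
    [lam] times [2 * dotp (b - p) (z n.+1 - p)]. The upper limit of the latter is at most zero, so
    Xu's lemma concludes. *)
Lemma hlwb_cvg : forall e : R, 0 < e -> exists K, forall n, (K <= n)%N ->
  enorm (z n - proj (polyhedron N C) b) <= e.
Proof.
set p := proj _ _; have Cp : polyhedron N C p := proj_in b cP.
suff sq : forall e : R, 0 < e -> exists K, forall n, (K <= n)%N ->
    dotp (z n - p) (z n - p) <= e.
  move=> e e0; have [K zK] := sq _ (exprn_gt0 2 e0).
  by exists K => n Kn; rewrite (enorm_le _ (ltW e0)) zK.
apply: (recursion_vanish (l := lam) (m := n0.+1) (f := fun=> 0)
  (t := fun n => 2 * dotp (b - p) (z n - p))).
- by move=> i /ltnW; exact: lam01.
- by move=> k M _; exact: lamoo.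
- by [].
- by exists 0 => n; rewrite big1.
- move=> e e0; have [K zK] := hlwb_dotp_limsup (divr_gt0 e0 (ltr0n _ 2)).
  by exists K => n Kn; have := zK n Kn; rewrite -/p; lra.
move=> n n0n; have n0n' : (n0 <= n.+1)%N by rewrite ltnW// ltnW.
have /andP[l0 l1] := lam01 n0n'; set l := lam n.+1 in l0 l1 *.
have zE : z n.+1 - p = (1 - l) *: (w n - p) + l *: (b - p).
  by apply/rowP => i; rewrite /l !mxE; ring.
have : dotp (w n - p) (w n - p) <= dotp (z n - p) (z n - p).
  have iN := mod1_bounds n.+1 N0; rewrite -le_enorm.
  by rewrite -[X in w n - X](proj_id (cC iN) (Cp _ iN)) (proj_nonexp _ _ (cC iN)).
rewrite {}zE; move: (w n - p) (b - p) (dotp (z n - p) _) => x1 x2 D wz.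
rewrite !dotpE (dotpC x2 x1).
have W0 := dotp_ge0 x1; have B0 := dotp_ge0 x2.
have l2 : 0 <= 1 - l by lra.
have h1 : (1 - l) * ((1 - l) * dotp x1 x1) <= (1 - l) * D.
  by rewrite ler_wpM2l//; have := mulr_ge0 l0 W0; lra.
have := mulr_ge0 l0 (mulr_ge0 l0 B0); lra.
Qed.

End Orbit.

(** Counterexamples for arbitrarily large [n] would have anchors clustering at some [b]. The orbit
    of [b] from 0 converges, the Lipschitz bound transfers this to nearby anchors, and other
    starting points are forgotten at the rate of the product. *)
Lemma hlwb_cvg_uniform (M : R) : forall e : R, 0 < e ->
  exists K, forall n, (K <= n)%N -> forall b x, enorm b <= M -> enorm x <= M ->
  enorm (hlwb N lam C n b x - proj (polyhedron N C) b) <= e.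
Proof.
move=> e e0; apply: contrapT => nK.
have /choice[g gP] K : exists u : nat * ('rV[R]_d * 'rV[R]_d), [/\ (K <= u.1)%N,
    enorm u.2.1 <= M, enorm u.2.2 <= M &
    e < enorm (hlwb N lam C u.1 u.2.1 u.2.2 - proj (polyhedron N C) u.2.1)].
  apply: contrapT => nn; apply: nK; exists K => n Kn b x bM xM.
  by rewrite leNgt; apply/negP => en; apply: nn; exists (n, (b, x)).
have [L [L1 HL]] := hlwb_lipschitz.
have [b clb] := enorm_cluster (x := fun K => (g K).2.1)
  (fun K => let: And4 _ h _ _ := gP K in h).
have e4 : 0 < e / 4 by lra.
have M0 : 0 <= M by have [_ h _ _] := gP 0%N; apply: le_trans h; exact: enorm_ge0.
have LM : 0 < L * M + 1 by rewrite ltr_wpDl ?mulr_ge0//; lra.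
have L4 : 0 < 2 * (L + 1) by lra.
have [K1 cvK] := hlwb_cvg b 0 e4.
have l01' i : (n0.+1 <= i)%N -> 0 <= lam i <= 1 by move=> /ltnW; exact: lam01.
have [K2 PK] := prod1B_vanish l01' (lamoo n0.+1) (divr_gt0 e4 LM).
have [m [Km]] := clb _ (divr_gt0 e0 L4) (maxn n0 (maxn K1 K2)).
rewrite ltr_pdivlMr// => bb'.
have [mn bM xM] := gP m; apply/negP; rewrite -leNgt.
move: (g m) mn bM xM bb' => -[n [b' x']] /= mn bM xM bb'.
move: (leq_trans Km mn); rewrite !geq_max => /and3P[n0n K1n K2n].
have := cvK n K1n; have := HL C cC n b' b 0 0; rewrite subrr enorm0 addr0.
have := proj_nonexp b b' cP; rewrite (enormC b b').
have := recursion_contract (T := fun i => proj (C (mod1 N i.+1)))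
  (z := fun n => hlwb N lam C n b' x') (z' := fun n => hlwb N lam C n b' 0)
  lam01 (fun i x y => proj_nonexp x y (cC (mod1_bounds i.+1 N0)))
  (leqnn n0) n0n (fun i _ => erefl) (fun i _ => erefl).
rewrite subrr enorm0 mulr0 add0r.
have := HL C cC n0 b' b' x' 0; rewrite subrr enorm0 subr0 add0r.
have := PK n.+1 (leqW K2n); rewrite ler_pdivlMr//.
have := prod1B_ge0 n.+1 l01'; set P := \prod_(_ <= i < _) _ => P0 PLM.
set u := enorm (_ - _) => uL cu lip cv prj.
have : P * u <= P * (L * M + 1).
  rewrite ler_wpM2l//; have : L * enorm x' <= L * M by rewrite ler_wpM2l//; lra.
  by lra.
move: cu lip cv prj; move: (hlwb N lam C n b' x') (hlwb N lam C n b' 0).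
move: (hlwb N lam C n b 0) (proj (polyhedron N C) b).
move: (proj (polyhedron N C) b') u uL => q' u uL z3 q z1 z2.
have := enorm_triangle z2 z1 q'; have := enorm_triangle z3 z2 q'.
have := enorm_triangle q z3 q'; lra.
Qed.

End Convergence.
End HLWB.

(** * Best approximation pairs and binding constraints *)

Section ProjectionEquality.
Variables (R : realType) (d : nat).
Implicit Types (x y p h v a b : 'rV[R]_d) (A B C : set 'rV[R]_d).

Lemma proj_eq_min C x p : closed_convex C -> C p ->
  (forall y, C y -> enorm (x - p) <= enorm (x - y)) -> proj C x = p.
Proof.
move=> cC Cp pmin; have Cq := proj_in x cC; have := proj_var x cC Cp.
have := pmin _ Cq; rewrite le_enorm; move: (proj C x) => q le var.
apply/subr0_eq; apply: dotp_eq0; move: le var; rewrite !dotpE.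
rewrite (dotpC p x) (dotpC q x) (dotpC q p); lra.
Qed.

Lemma best_approx_pair_proj A B a b : closed_convex A -> closed_convex B ->
  best_approx_pair A B a b -> proj B a = b /\ proj A b = a.
Proof.
move=> cA cB [Aa Bb abmin]; split; apply: proj_eq_min => // y Cy.
  exact: abmin.
by rewrite enormC (enormC b); exact: abmin.
Qed.

(** Equality case of firm nonexpansiveness: the squared distance between [P] and [D] is at most
    [dotp D D - dotp P P]. *)
Lemma proj_isometric C x y : closed_convex C ->
  enorm (x - y) <= enorm (proj C x - proj C y) -> proj C x - proj C y = x - y.
Proof.
move=> cC; rewrite le_enorm => le; have := proj_firm x y cC.
move: le; set P := proj C x - proj C y; set D := x - y.
move: P D => P D le firm; apply/subr0_eq; apply: dotp_eq0.
by rewrite !dotpE (dotpC P D); lra.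
Qed.

(** If a full cycle loses no distance to [a], both projections are in the equality case. Hence
    [proj B x = x + (b - a)], and the second projection leads back to [x]. *)
Lemma alternating_isometric A B a b x : closed_convex A -> closed_convex B ->
  proj B a = b -> proj A b = a ->
  enorm (x - a) <= enorm (proj A (proj B x) - a) -> A x /\ B (x + (b - a)).
Proof.
move=> cA cB Ba Ab le.
have leB := proj_nonexp x a cB; have leA := proj_nonexp (proj B x) b cA.
rewrite Ba in leB; rewrite Ab in leA.
have eB : proj B x - b = x - a.
  by rewrite -{1}Ba; apply: proj_isometric => //; rewrite Ba (le_trans le).
have eA : proj A (proj B x) - a = proj B x - b.
  by rewrite -{1}Ab; apply: proj_isometric => //; rewrite Ab eB.
have xE : proj A (proj B x) = x.
  by rewrite -[LHS](subrK a) eA eB subrK.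
have xvE : proj B x = x + (b - a).
  by rewrite -[LHS](subrK b) eB addrAC addrA.
by split; [rewrite -xE; exact: proj_in|rewrite -xvE; exact: proj_in].
Qed.

End ProjectionEquality.

Section Inner.
Variables (R : realType) (d : nat).
Implicit Types (x y p h v a b : 'rV[R]_d) (S : set 'rV[R]_d).

(** Interior points in the Euclidean norm; for a constraint [S], the points at which it does not
    bind. *)
Definition inner S x := exists r : R, 0 < r /\ forall y, enorm (y - x) <= r -> S y.

Lemma inner_convex S x y (t : R) : closed_convex S -> 0 < t <= 1 ->
  inner S x -> S y -> inner S (t *: x + (1 - t) *: y).
Proof.
move=> [_ _ cv] /andP[t0 t1] [r [r0 Sr]] Sy; exists (t * r); split.
  exact: mulr_gt0.
move=> z zr; set m := _ *: x + _ in zr.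
have -> : z = t *: (x + t^-1 *: (z - m)) + (1 - t) *: y.
  rewrite scalerDr scalerA mulfV ?gt_eqF// scale1r /m.
  by apply/rowP => i; rewrite !mxE; ring.
apply: cv => //; first by rewrite (ltW t0).
apply: Sr; rewrite addrAC subrr add0r enormZ gtr0_norm ?invr_gt0//.
by rewrite mulrC ler_pdivrMr// mulrC.
Qed.

(** Points of a half-space that are not interior lie on its boundary hyperplane; two of them
    differing by a multiple of [h] make [h] orthogonal to the normal. *)
Lemma not_inner_direction S x h (t : R) : halfspace_or_full S -> 0 < t ->
  S x -> ~ inner S x -> S (x + t *: h) -> ~ inner S (x + t *: h) ->
  forall y, S y -> S (y + h) /\ S (y - h).
Proof.
move=> /halfspace_or_fullP[_ [u [c [-> _]]]] t0.
have boundary z : dotp u z <= c -> ~ inner [set x | dotp u x <= c] z ->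
    dotp u z = c.
  move=> uz nz; apply/eqP; rewrite eq_le uz/= leNgt; apply/negP => ult.
  have u1 : 0 < enorm u + 1 by rewrite ltr_wpDl ?enorm_ge0.
  apply: nz; exists ((c - dotp u z) / (enorm u + 1)); split.
    by rewrite divr_gt0// subr_gt0.
  move=> y /=; rewrite ler_pdivlMr// => yz.
  have -> : dotp u y = dotp u z + dotp u (y - z) by rewrite !dotpE; ring.
  have := dotp_le u (y - z); have := enorm_ge0 (y - z); lra.
move=> /= /boundary ux /ux {}ux /boundary uxh /uxh; rewrite dotpDr ux dotpZr.
move=> /eqP; rewrite -subr_eq0 addrAC subrr add0r mulf_eq0 gt_eqF//=.
by move=> /eqP uh y uy; rewrite !dotpE uh subr0 addr0.
Qed.

End Inner.

(** A point satisfying the largest number of the [Q i] works: its join with [y] cannot satisfy any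
    further ones. *)
Lemma exists_dominating (T : Type) (I : finType) (E : set T) (Q : I -> T -> Prop) :
  E !=set0 ->
  (forall x y, E x -> E y -> exists z, E z /\ forall i, Q i x \/ Q i y -> Q i z) ->
  exists x, E x /\ forall y, E y -> forall i, Q i y -> Q i x.
Proof.
move=> [x0 Ex0] join; pose f x := #|[pred i | `[< Q i x >]]|.
pose P := [pred n | `[< exists x, E x /\ f x = n >]].
have exP : exists n, P n by exists (f x0); apply/asboolP; exists x0.
have ubP n : P n -> (n <= #|I|)%N.
  by move=> /asboolP[x [_ <-]]; exact: max_card.
have [m /asboolP[x [Ex fx]] mmax] := ex_maxnP exP ubP.
exists x; split=> // y Ey i Qiy.
have [z [Ez zQ]] := join x y Ex Ey.
have sub : [pred i | `[< Q i x >]] \subset [pred i | `[< Q i z >]].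
  by apply/fintype.subsetP => j /asboolP Qj; apply/asboolP/zQ; left.
have cardE : #|[pred i | `[< Q i x >]]| = #|[pred i | `[< Q i z >]]|.
  apply/eqP; rewrite eqn_leq subset_leq_card//=.
  by rewrite -/(f x) fx; apply: mmax; apply/asboolP; exists z.
have := subset_cardP cardE sub i; rewrite !inE => QE.
by apply/asboolP; rewrite QE; apply/asboolP/zQ; right.
Qed.

(** * Dropping the constraints that do not bind *)

Section Localization.
Variables (R : realType) (d N : nat).
Implicit Types (x y p h : 'rV[R]_d) (C : nat -> set 'rV[R]_d).

(** Dropped constraints become the full space instead of being removed, so that indices and cyclic
    order are unchanged. *)
Definition localize C p i := if `[< inner (C i) p >] then setT else C i.

Lemma localize_halfspace C p i :
  halfspace_or_full (C i) -> halfspace_or_full (localize C p i).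
Proof. by rewrite /localize; case: ifP => // _ _; right. Qed.

Lemma polyhedron_localize C p x :
  polyhedron N C x -> polyhedron N (localize C p) x.
Proof. by move=> Cx i iN; rewrite /localize; case: ifP => // _; exact: Cx. Qed.

Lemma localize_radius C p : exists r : R, 0 < r /\
  forall i, (1 <= i <= N)%N -> inner (C i) p ->
    forall y, enorm (y - p) <= r -> C i y.
Proof.
pose Q (i : 'I_N) r := inner (C i.+1) p ->
  forall y, enorm (y - p) <= r -> C i.+1 y.
have [i r s rs Qs Ci y yr|i|r [r0 Qr]] := finite_threshold (Q := Q).
- by apply: Qs => //; exact: le_trans rs.
- have [[r [r0 Cr]]|nC] := pselect (inner (C i.+1) p); last by exists 1; split=> // /nC.
  by exists r; split=> // _; exact: Cr.
exists r; split=> // -[//|i] iN; exact: (Qr (Ordinal iN)).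
Qed.

(** Binding constraints hold on the segment by convexity, dropped ones because the point is within
    [r] of [p]. *)
Lemma localize_segment C p x (r t : R) :
  (forall i, (1 <= i <= N)%N -> closed_convex (C i)) ->
  (forall i, (1 <= i <= N)%N -> inner (C i) p ->
    forall y, enorm (y - p) <= r -> C i y) ->
  polyhedron N C p -> polyhedron N (localize C p) x ->
  0 <= t <= 1 -> t * enorm (x - p) <= r -> polyhedron N C (p + t *: (x - p)).
Proof.
move=> cC Cr Cp Cx t01 tr i iN; have /andP[t0 t1] := t01.
have [Ci|nCi] := pselect (inner (C i) p).
  by apply: Cr => //; rewrite addrAC subrr add0r enormZ ger0_norm.
have := Cx _ iN; rewrite /localize asboolF// => Cix.
have [_ _ cv] := cC _ iN; have := cv x p t t01 Cix (Cp _ iN).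
by congr (C i _); apply/rowP => j; rewrite !mxE; ring.
Qed.

(** The variational inequality at [p] is local: a point of the localized polyhedron, pulled towards
    [p], lies in the original one, and the inequality scales by [t]. *)
Lemma localize_proj C p q :
  (forall i, (1 <= i <= N)%N -> halfspace_or_full (C i)) ->
  polyhedron N C p -> proj (polyhedron N C) q = p ->
  proj (polyhedron N (localize C p)) q = p.
Proof.
move=> hC Cp qp.
have cC i iN := halfspace_or_full_closed_convex (hC i iN).
have cL i iN := halfspace_or_full_closed_convex (localize_halfspace p (hC i iN)).
have C0 : polyhedron N C !=set0 by exists p.
have L0 : polyhedron N (localize C p) !=set0.
  by exists p; exact: polyhedron_localize.
apply: proj_unique; [exact: polyhedron_closed_convex|exact: polyhedron_localize|].
move=> x Lx; have [r [r0 Cr]] := localize_radius C p.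
have xp := enorm_ge0 (x - p).
have rx : 0 < r + enorm (x - p) by lra.
pose t := r / (r + enorm (x - p)).
have t0 : 0 < t by rewrite divr_gt0.
have t1 : t <= 1 by rewrite ler_pdivrMr//; lra.
have tr : t * enorm (x - p) <= r.
  by rewrite /t mulrAC ler_pdivrMr// ler_wpM2l ?lerDr ?ltW.
have t01 : 0 <= t <= 1 by rewrite ltW.
have := proj_var q (polyhedron_closed_convex cC C0)
  (localize_segment cC Cr Cp Lx t01 tr).
by rewrite qp addrAC subrr add0r dotpZr pmulr_rle0.
Qed.

End Localization.

Section BestPairs.
Variables (R : realType) (d N : nat) (A B : nat -> set 'rV[R]_d) (v : 'rV[R]_d).
Implicit Types (x y p h a e : 'rV[R]_d).
Hypothesis hA : forall i, (1 <= i <= N)%N -> halfspace_or_full (A i).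
Hypothesis hB : forall i, (1 <= i <= N)%N -> halfspace_or_full (B i).

Let cA i (iN : (1 <= i <= N)%N) := halfspace_or_full_closed_convex (hA iN).
Let cB i (iN : (1 <= i <= N)%N) := halfspace_or_full_closed_convex (hB iN).

(** With [v] the displacement of one best pair, [(a, a + v)] is again a best pair. *)
Definition translation_pair a := polyhedron N A a /\ polyhedron N B (a + v).

(* Such points, at which as few constraints as possible bind, stand in for the
   relative interior of the set of best pairs. *)
Definition generic a := translation_pair a /\ forall e, translation_pair e ->
  forall i, (1 <= i <= N)%N -> (inner (A i) e -> inner (A i) a) /\
    (inner (B i) (e + v) -> inner (B i) (a + v)).

Lemma translation_pair_convex a e (t : R) : 0 <= t <= 1 ->
  translation_pair a -> translation_pair e ->
  translation_pair (t *: a + (1 - t) *: e).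
Proof.
move=> t01 [Aa Bav] [Ae Bev]; split=> i iN.
  by have [_ _ cv] := cA iN; apply: cv => //; [exact: Aa|exact: Ae].
have [_ _ cv] := cB iN; have := cv _ _ t t01 (Bav i iN) (Bev i iN).
by congr (B i _); apply/rowP => j; rewrite !mxE; ring.
Qed.

Lemma inner_segment a e (t : R) i : (1 <= i <= N)%N -> 0 < t <= 1 ->
  translation_pair e ->
  (inner (A i) a -> inner (A i) (t *: a + (1 - t) *: e)) /\
  (inner (B i) (a + v) -> inner (B i) (t *: a + (1 - t) *: e + v)).
Proof.
move=> iN t01 [Ae Be]; split=> [Aia|Biav].
  by apply: inner_convex => //; [exact: cA|exact: Ae].
have := inner_convex (cB iN) t01 Biav (Be _ iN).
by congr (inner (B i) _); apply/rowP => j; rewrite !mxE; ring.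
Qed.

(** Genericity survives every move towards [e] that stops short of it, so [e] is a limit of generic
    points. *)
Lemma generic_segment a e (t : R) : generic a -> translation_pair e ->
  0 < t <= 1 -> generic (t *: a + (1 - t) *: e).
Proof.
move=> [Ea ga] Ee t01; have /andP[t0 t1] := t01; split.
  by apply: translation_pair_convex => //; rewrite ltW.
move=> e' Ee' i iN; have [gA gB] := ga _ Ee' _ iN.
have [iA iB] := inner_segment a iN t01 Ee.
by split=> [/gA/iA|/gB/iB].
Qed.

(** Midpoints serve as joins: a constraint slack at one of two pairs is slack at their midpoint. *)
Lemma generic_exists e : translation_pair e -> exists a, generic a.
Proof.
move=> Ee.
pose Q (i : 'I_N + 'I_N) x := match i with
  inl i => inner (A i.+1) x | inr i => inner (B i.+1) (x + v) end.
have [||a [Ea dom]] := @exists_dominating _ _ translation_pair Q.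
- by exists e.
- move=> x y Ex Ey; exists (2^-1 *: x + (1 - 2^-1) *: y); split.
    by apply: translation_pair_convex => //; lra.
  have half : 0 < (2^-1 : R) <= 1 by lra.
  have half' : 0 < 1 - (2^-1 : R) <= 1 by lra.
  have swap : 2^-1 *: x + (1 - 2^-1) *: y =
      (1 - 2^-1) *: y + (1 - (1 - 2^-1)) *: x by rewrite subKr addrC.
  case=> i; have iN : (1 <= i.+1 <= N)%N by rewrite ltn_ord.
    have [hx _] := inner_segment x iN half Ey.
    have [hy _] := inner_segment y iN half' Ex.
    by case=> [/hx//|/hy]; rewrite -swap.
  have [_ hx] := inner_segment x iN half Ey.
  have [_ hy] := inner_segment y iN half' Ex.
  by case=> [/hx//|/hy]; rewrite -swap.
exists a; split=> // e' Ee' [//|i] iN.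
by split; [exact: (dom _ Ee' (inl (Ordinal iN)))|exact: (dom _ Ee' (inr (Ordinal iN)))].
Qed.

(** The common lineality space of the constraints binding at [a] or [a + v]. *)
Definition lineal a h := forall i, (1 <= i <= N)%N ->
  (forall y, localize A a i y -> localize A a i (y + h) /\ localize A a i (y - h)) /\
  (forall y, localize B (a + v) i y ->
    localize B (a + v) i (y + h) /\ localize B (a + v) i (y - h)).

(** A small step from [a] towards [x] yields a pair of the original system. By genericity the
    constraints binding at the pair of [a] still bind there, so [x - a] runs along their boundary
    hyperplanes. *)
Lemma generic_lineal a x : generic a ->
  polyhedron N (localize A a) x -> polyhedron N (localize B (a + v)) (x + v) ->
  lineal a (x - a).
Proof.
move=> [[Aa Bav] ga] Ax Bxv.
have [r [r0 Ar]] := localize_radius N A a.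
have [s [s0 Bs]] := localize_radius N B (a + v).
have xa := enorm_ge0 (x - a).
pose m := Num.min r s; have m0 : 0 < m by rewrite lt_min r0.
have mr : m <= r by rewrite ge_min lexx.
have ms : m <= s by rewrite ge_min lexx orbT.
have mx : 0 < m + enorm (x - a) by lra.
pose t := m / (m + enorm (x - a)).
have t0 : 0 < t by rewrite divr_gt0.
have t01 : 0 <= t <= 1 by rewrite ltW//= ler_pdivrMr//; lra.
have tm : t * enorm (x - a) <= m.
  by rewrite /t mulrAC ler_pdivrMr// ler_wpM2l ?lerDr ?ltW.
have Ee : translation_pair (a + t *: (x - a)).
  split; first exact: (localize_segment cA Ar Aa Ax t01 (le_trans tm mr)).
  have xvE : x + v - (a + v) = x - a by apply/rowP => i; rewrite !mxE; ring.
  rewrite addrAC -xvE; apply: (localize_segment cB Bs Bav Bxv t01).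
  by rewrite xvE (le_trans tm).
move=> i iN; have [gA gB] := ga _ Ee _ iN; rewrite /localize; split.
  case: asboolP => // nAi; have [AE _] := Ee.
  by apply: (not_inner_direction (hA iN) t0 (Aa _ iN) nAi (AE _ iN)) => /gA.
case: asboolP => // nBi; have [_ BE] := Ee; rewrite addrAC in gB BE.
by apply: (not_inner_direction (hB iN) t0 (Bav _ iN) nBi (BE _ iN)) => /gB.
Qed.

(** Without such a [delta], points losing less and less would cluster at some [y] that loses
    nothing. Then [y - a] is lineal, hence orthogonal to itself, and [y = a] contradicts [e > 0]. *)
Lemma alternating_contraction a : generic a ->
  proj (polyhedron N B) a = a + v -> proj (polyhedron N A) (a + v) = a ->
  forall e : R, 0 < e -> exists delta, 0 < delta /\ forall x,
    (forall h, lineal a h -> dotp h (x - a) = 0) -> enorm (x - a) <= e ->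
    enorm (proj (polyhedron N (localize A a))
      (proj (polyhedron N (localize B (a + v))) x) - a) <= e - delta.
Proof.
move=> ga Ba Av e e0; have [[Aa Bav] _] := ga.
have LB := localize_proj hB Bav Ba; have LA := localize_proj hA Aa Av.
have cLA : closed_convex (polyhedron N (localize A a)).
  apply: polyhedron_closed_convex; last by exists a; exact: polyhedron_localize.
  by move=> i iN; exact/halfspace_or_full_closed_convex/localize_halfspace/hA.
have cLB : closed_convex (polyhedron N (localize B (a + v))).
  apply: polyhedron_closed_convex; last by exists (a + v); exact: polyhedron_localize.
  by move=> i iN; exact/halfspace_or_full_closed_convex/localize_halfspace/hB.
pose T x := proj (polyhedron N (localize A a))
  (proj (polyhedron N (localize B (a + v))) x).
have T1 x y : enorm (T x - T y) <= enorm (x - y).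
  exact: le_trans (proj_nonexp _ _ cLA) (proj_nonexp _ _ cLB).
apply: contrapT => nd; have [w [w01 wlt]] := vanishing_seq R.
have /choice[x xP] k : exists x, [/\ forall h, lineal a h -> dotp h (x - a) = 0,
    enorm (x - a) <= e & e - w k < enorm (T x - a)].
  apply: contrapT => nx; apply: nd; exists (w k).
  split=> [|x xh xe]; first by have /andP[] := w01 k.
  by rewrite leNgt; apply/negP => lt; apply: nx; exists x.
have [|y cly] := enorm_cluster (x := x) (M := e + enorm a).
  by move=> k; have [_ xe _] := xP k; have := enormD (x k - a) a; rewrite subrK; lra.
have yh h : lineal a h -> dotp h (y - a) = 0.
  move=> lh; apply/eqP; rewrite -normr_le0; apply: le_of_lt_addr => c c0.
  rewrite add0r; have h1 : 0 < enorm h + 1 by rewrite ltr_wpDl ?enorm_ge0.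
  have [k [_]] := cly _ (divr_gt0 c0 h1) 0%N; rewrite ltr_pdivlMr// => xy.
  have [/(_ _ lh) xh _ _] := xP k.
  have -> : y - a = (x k - a) - (x k - y).
    by apply/rowP => i; rewrite !mxE; ring.
  rewrite dotpDr xh add0r dotpNr normrN (le_lt_trans (dotp_abs_le _ _))//.
  by have := enorm_ge0 (x k - y); lra.
have ye : enorm (y - a) <= e.
  apply: le_of_lt_addr => c c0; have [k [_ xy]] := cly _ c0 0%N.
  have [_ xe _] := xP k; have := enorm_triangle (x k) y a.
  by rewrite (enormC y (x k)); lra.
have Ty : e <= enorm (T y - a).
  apply: le_of_lt_addr => c c0; have c2 : 0 < c / 2 by lra.
  have [K wK] := wlt _ c2; have [k [Kk xy]] := cly _ c2 K.
  have [_ _ xT] := xP k; have := wK k Kk; have := T1 (x k) y.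
  have := enorm_triangle (T y) (T (x k)) a; move: (T y) (T (x k)) xT => y1 y2; lra.
have [|Ay Byv] := alternating_isometric (x := y) cLA cLB LB LA.
  exact: le_trans Ty.
rewrite addrAC subrr add0r in Byv.
have := yh _ (generic_lineal ga Ay Byv) => ya0.
have yaE : y = a by apply/subr0_eq/dotp_eq0; rewrite ya0.
by move: Ty; rewrite yaE /T LB LA subrr enorm0; lra.
Qed.

End BestPairs.

(** * The alternating algorithm *)

(** The error grows with [D k], so boundedness comes first; after that the errors are at most a
    constant times the summable [w]. *)
Lemma quasi_decreasing (R : realType) (D w : nat -> R) (L c : R) (m : nat) :
  0 < L -> 0 <= c -> (forall k, 0 <= D k) ->
  (forall k, (m <= k)%N -> 0 <= w k) ->
  (exists S : R, forall n, \sum_(m <= k < n) w k <= S) ->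
  (forall k, (m <= k)%N -> D k.+1 <= D k + w k * (L * D k + c)) ->
  forall e : R, 0 < e -> exists K, forall k l, (K <= k)%N -> (k <= l)%N ->
    D l <= D k + e.
Proof.
move=> L0 c0 D0 w0 [S wS] step.
have L2 : 0 < (2 * L)^-1 by rewrite invr_gt0 mulr_gt0.
have [K [mK wK]] := nonneg_tail w0 wS L2.
(* The tail sums of [w] are at most [(2 * L)^-1], and [M] solves
   [D K + (L * M + c) / (2 * L) = M]. *)
pose M := 2 * D K + c / L.
have cL : 0 <= c / L by rewrite divr_ge0// ltW.
have M0 : 0 <= M by have := D0 K; rewrite /M; lra.
have LMc : 0 < L * M + c + 1 by have := mulr_ge0 (ltW L0) M0; lra.
have sumw k l : (K <= k)%N -> (k <= l)%N -> (forall j, (k <= j < l)%N -> D j <= M) ->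
    D l <= D k + (\sum_(k <= j < l) w j) * (L * M + c).
  move=> Kk; elim: l => [|l IH]; rewrite leq_eqVlt => /predU1P[->|kl] DM.
  - by rewrite big_geq// mul0r addr0.
  - by [].
  - by rewrite big_geq// mul0r addr0.
  have mk : (m <= l)%N by rewrite (leq_trans mK)// (leq_trans Kk).
  have := step l mk; rewrite big_nat_recr//= mulrDl.
  have IH' : D l <= D k + (\sum_(k <= j < l) w j) * (L * M + c).
    by apply: (IH kl) => j /andP[kj jl]; apply: DM; rewrite kj ltnW.
  have Dl : D l <= M by apply: DM; rewrite ltnSn andbT -ltnS.
  have : w l * (L * D l + c) <= w l * (L * M + c).
    by rewrite ler_wpM2l ?w0// lerD2r ler_pM2l.
  lra.
have bound l : (K <= l)%N -> D l <= M.
  elim/ltn_ind: l => l IH Kl.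
  have : D l <= D K + (\sum_(K <= j < l) w j) * (L * M + c).
    by apply: sumw => // j /andP[Kj jl]; exact: IH.
  have : (\sum_(K <= j < l) w j) * (L * M + c) <= (2 * L)^-1 * (L * M + c).
    by rewrite ler_wpM2r ?wK//; have := mulr_ge0 (ltW L0) M0; lra.
  have -> : (2 * L)^-1 * (L * M + c) = M / 2 + c / L / 2.
    by field; rewrite gt_eqF.
  rewrite /M; lra.
move=> e e0; have [K' [_ wK']] := nonneg_tail w0 wS (divr_gt0 e0 LMc).
exists (maxn K K') => k l; rewrite geq_max => /andP[Kk K'k] kl.
have := sumw k l Kk kl (fun j h => bound j (leq_trans Kk (proj1 (andP h)))).
have := wK' k l K'k; rewrite ler_pdivlMr//.
have : 0 <= \sum_(k <= j < l) w j.
  rewrite big_nat_cond sumr_ge0// => j /andP[/andP[kj _] _].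
  by rewrite w0// (leq_trans mK)// (leq_trans Kk).
lra.
Qed.

Lemma orbit_exists (T : Type) (f : nat -> T -> T) (K : nat) (x : T) :
  exists y : nat -> T, y K = x /\ forall k, (K <= k)%N -> y k.+1 = f k (y k).
Proof.
exists (fun k => iteri (k - K) (fun i => f (i + K)%N) x).
by rewrite subnn; split=> // k Kk; rewrite subSn//= subnK.
Qed.

Lemma hlwb_dotp (R : realType) (d N : nat) (lam : nat -> R)
    (C : nat -> set 'rV[R]_d) (n : nat) (h b x : 'rV[R]_d) : (0 < N)%N ->
  (forall i, (1 <= i <= N)%N -> forall y, dotp h (proj (C i) y) = dotp h y) ->
  dotp h b = dotp h x -> dotp h (hlwb N lam C n b x) = dotp h x.
Proof.
move=> N0 hC hb; elim: n => //= n IH.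
by rewrite dotpDr !dotpZr hC ?mod1_bounds// IH hb; ring.
Qed.

Section Alternation.
Variables (R : realType) (d N : nat) (A B : nat -> set 'rV[R]_d).
Variables (lam : nat -> R) (n0 : nat) (nk : nat -> nat) (v : 'rV[R]_d).
Implicit Types (x y h a e : 'rV[R]_d).
Hypothesis N0 : (0 < N)%N.
Hypothesis hA : forall i, (1 <= i <= N)%N -> halfspace_or_full (A i).
Hypothesis hB : forall i, (1 <= i <= N)%N -> halfspace_or_full (B i).
Hypothesis lam01 : forall n, (n0 <= n)%N -> 0 <= lam n <= 1.
Hypothesis lam0 : forall e : R, 0 < e ->
  exists K, forall n, (K <= n)%N -> lam n <= e.
Hypothesis lamoo : forall m (M : R), exists n, M <= \sum_(m <= i < n) lam i.
Hypothesis lamN : exists S : R, forall n,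
  \sum_(1 <= i < n) `|lam i - lam (i + N)%N| <= S.
Hypothesis nk_homo : {homo nk : k l / (k <= l)%N}.
Hypothesis nkoo : forall M, exists K, forall k, (K <= k)%N -> (M <= nk k)%N.

(* The half-step k is governed by B if k is even and by A if k is odd, and
   leads from a neighbourhood of target a k to one of target a k.+1. *)
Definition family k := if odd k then A else B.
Definition target a k := if odd k then a + v else a.
Definition local_family a k := localize (family k) (target a k.+1).

Lemma family_halfspace k i : (1 <= i <= N)%N -> halfspace_or_full (family k i).
Proof. by rewrite /family; case: odd; [exact: hA|exact: hB]. Qed.

Let cF k i iN := halfspace_or_full_closed_convex (@family_halfspace k i iN).

Lemma local_family_closed_convex a k i : (1 <= i <= N)%N ->
  closed_convex (local_family a k i).
Proof.
by move=> iN; exact/halfspace_or_full_closed_convex/localize_halfspace/family_halfspace.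
Qed.

Lemma target_in a k : translation_pair N A B v a ->
  polyhedron N (family k) (target a k.+1).
Proof. by case=> Aa Bav; rewrite /family /target /=; case: odd. Qed.

Lemma target_le a k : enorm (target a k) <= enorm a + enorm v.
Proof.
rewrite /target; case: odd; first exact: enormD.
by rewrite lerDl enorm_ge0.
Qed.

Lemma hlwb_cvg_uniform_parity (F : nat -> nat -> set 'rV[R]_d) (M : R) :
  (forall k i, (1 <= i <= N)%N -> closed_convex (F k i)) ->
  (forall k, polyhedron N (F k) !=set0) -> (forall k, F k = F (odd k)) ->
  forall e : R, 0 < e -> exists K, forall k n, (K <= n)%N -> forall b x,
    enorm b <= M -> enorm x <= M ->
    enorm (hlwb N lam (F k) n b x - proj (polyhedron N (F k)) b) <= e.
Proof.
move=> cFF F0 Fodd e e0.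
have [K1 HK1] := hlwb_cvg_uniform N0 lam01 (cFF 0%N) (F0 0%N) lam0 lamoo lamN M e0.
have [K2 HK2] := hlwb_cvg_uniform N0 lam01 (cFF 1%N) (F0 1%N) lam0 lamoo lamN M e0.
exists (maxn K1 K2) => k n; rewrite geq_max => /andP[K1n K2n] b x bM xM.
by rewrite Fodd; case: (odd k); [exact: HK2|exact: HK1].
Qed.

Section Reference.
Variable a : 'rV[R]_d.
Hypothesis ga : generic N A B v a.
Hypothesis Ba : proj (polyhedron N B) a = a + v.
Hypothesis Av : proj (polyhedron N A) (a + v) = a.

Let T k := proj (polyhedron N (local_family a k)).

Let Ea : translation_pair N A B v a := proj1 ga.

Lemma local_polyhedron_closed_convex k :
  closed_convex (polyhedron N (local_family a k)).
Proof.
apply: polyhedron_closed_convex => [i iN|]; first exact: local_family_closed_convex.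
by exists (target a k.+1); exact/polyhedron_localize/target_in.
Qed.

Lemma local_proj_target k : T k (target a k) = target a k.+1.
Proof.
apply: localize_proj; [exact: family_halfspace|exact: target_in|].
by rewrite /family /target /=; case: odd.
Qed.

Lemma lineal_dotp h : lineal N A B v a h ->
  (forall k i, (1 <= i <= N)%N -> forall y,
    dotp h (proj (local_family a k i) y) = dotp h y) /\
  forall k, dotp h (target a k) = dotp h a.
Proof.
move=> lh; have hk k i : (1 <= i <= N)%N -> forall y, local_family a k i y ->
    local_family a k i (y + h) /\ local_family a k i (y - h).
  move=> iN; have [hA' hB'] := lh i iN.
  by rewrite /local_family /family /target /=; case: odd.
split=> [k i iN y|k].
  by apply: proj_dir; [exact: local_family_closed_convex|exact: hk].
(* Projecting [a + v] gives [a] and keeps the component along [h], so [v] is orthogonal to [h]. *)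
have := @proj_dir R d _ (target a 1) h (local_polyhedron_closed_convex 1).
rewrite -/(T 1) local_proj_target => /(_ _) dE.
rewrite /target; case: odd => //; apply/esym/dE => y Ly.
by split=> i iN; have [] := hk 1%N i iN _ (Ly _ iN).
Qed.

(** Even iterates stay within [e / 3], since the gain [delta] of a full cycle pays for its two
    half-step errors [eta]; odd ones follow by nonexpansiveness. The inner iterates are bounded as
    well, because the dropped constraints must not act during a half-step. *)
Lemma reference_stable : forall e : R, 0 < e -> exists K, forall K0,
  (K <= K0)%N -> ~~ odd K0 -> forall y : nat -> 'rV[R]_d, y K0 = target a K0 ->
  (forall k, (K0 <= k)%N ->
    y k.+1 = hlwb N lam (local_family a k) (nk k) (y k) (target a k.+1)) ->
  forall k, (K0 <= k)%N -> enorm (y k - target a k) <= e /\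
    forall n, (nk K0 <= n)%N ->
      enorm (hlwb N lam (local_family a k) n (y k) (target a k.+1) -
        target a k.+1) <= e.
Proof.
move=> e e0; have e3 : 0 < e / 3 by lra.
have [delta [delta0 contr]] := alternating_contraction hA hB ga Ba Av e3.
pose eta := Num.min (delta / 2) (e / 3).
have eta0 : 0 < eta by rewrite lt_min e3 divr_gt0.
have eta_d : eta <= delta / 2 by rewrite ge_min lexx.
have eta_e : eta <= e / 3 by rewrite ge_min lexx orbT.
clearbody eta.
have parity k : local_family a k = local_family a (odd k).
  by rewrite /local_family /family /target /= oddb.
have L0 k : polyhedron N (local_family a k) !=set0.
  by exists (target a k.+1); exact/polyhedron_localize/target_in.
have [K1 unif] := hlwb_cvg_uniform_parity (enorm a + enorm v + e)
  (local_family_closed_convex a) L0 parity eta0.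
have [K nkK] := nkoo K1.
exists K => K0 KK0 evK0 y yK0 yS.
have T1 k x x' : enorm (T k x - T k x') <= enorm (x - x').
  exact: proj_nonexp (local_polyhedron_closed_convex k).
have half k n : (K0 <= k)%N -> enorm (y k - target a k) <= e -> (nk K0 <= n)%N ->
    enorm (hlwb N lam (local_family a k) n (y k) (target a k.+1) - T k (y k)) <= eta.
  move=> K0k ye K0n; apply: unif; first exact: leq_trans (nkK _ KK0) K0n.
    have := enormD (y k - target a k) (target a k); rewrite subrK.
    by have := target_le a k; lra.
  by have := target_le a k.+1; lra.
have halfS k : (K0 <= k)%N -> enorm (y k - target a k) <= e ->
    enorm (y k.+1 - T k (y k)) <= eta.
  by move=> K0k ye; rewrite yS//; apply: half => //; exact: nk_homo.
have odd_step k : (K0 <= k)%N -> enorm (y k - target a k) <= e / 3 ->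
    enorm (y k.+1 - target a k.+1) <= 2 * (e / 3).
  move=> K0k ye; have := halfS k K0k ltac:(lra); have := T1 k (y k) (target a k).
  rewrite local_proj_target.
  have := enorm_triangle (T k (y k)) (y k.+1) (target a k.+1); lra.
(* The contraction holds only on the slice orthogonal to the lineality space, which the orbit never
   leaves. *)
have orth k h : (K0 <= k)%N -> lineal N A B v a h -> dotp h (y k) = dotp h a.
  move=> K0k /lineal_dotp[hP hT]; elim: k K0k => [|k IH]; rewrite leq_eqVlt.
    by rewrite orbF => /eqP <-; rewrite yK0 hT.
  move=> /predU1P[<-|K0k]; first by rewrite yK0 hT.
  by rewrite yS// hlwb_dotp//; [exact: hP|rewrite IH// hT].
have even_bound i : enorm (y (K0 + i.*2)%N - a) <= e / 3.
  elim: i => [|i IH].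
    by rewrite addn0 yK0 /target (negbTE evK0) subrr enorm0 ltW.
  have K0k : (K0 <= K0 + i.*2)%N by exact: leq_addr.
  have evk : odd (K0 + i.*2) = false by rewrite oddD odd_double addbF (negbTE evK0).
  rewrite doubleS !addnS; move: (K0 + i.*2)%N K0k evk IH => k K0k evk IH.
  have tk : target a k = a by rewrite /target evk.
  have yk : enorm (y k - target a k) <= e / 3 by rewrite tk.
  have yk1 := odd_step k K0k yk.
  have := halfS k.+1 (leqW K0k) ltac:(lra); have := halfS k K0k ltac:(lra).
  have := T1 k.+1 (y k.+1) (T k (y k)).
  have : enorm (T k.+1 (T k (y k)) - a) <= e / 3 - delta.
    rewrite /T /local_family /family /target /= evk /=; apply: contr => // h lh.
    by rewrite dotpDr dotpNr orth// subrr.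
  have := enorm_triangle (T k.+1 (y k.+1)) (y k.+2) a.
  have := enorm_triangle (T k.+1 (T k (y k))) (T k.+1 (y k.+1)) a.
  move: (T k.+1 (T k (y k))) (T k.+1 (y k.+1)) (T k (y k)) => z1 z2 z3; lra.
have bound k : (K0 <= k)%N -> enorm (y k - target a k) <= 2 * (e / 3).
  move=> K0k; rewrite -(subnKC K0k) -(odd_double_half (k - K0)).
  have evi i : odd (K0 + i.*2) = false by rewrite oddD odd_double addbF (negbTE evK0).
  have ev i : enorm (y (K0 + i.*2)%N - target a (K0 + i.*2)) <= e / 3.
    by rewrite /target evi.
  case: odd; last by rewrite add0n; have := ev (k - K0)./2; lra.
  by rewrite add1n addnS; apply: odd_step => //; exact: leq_addr.
move=> k K0k; have yk := bound k K0k; split=> [|n K0n]; first lra.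
have := half k n K0k ltac:(lra) K0n; have := T1 k (y k) (target a k).
rewrite local_proj_target.
have := enorm_triangle (T k (y k)) (hlwb N lam (local_family a k) n (y k)
  (target a k.+1)) (target a k.+1).
by move: (hlwb _ _ _ _ _ _) (T k (y k)) => z1 z2; lra.
Qed.

End Reference.
Hypothesis prod_sum : forall k0, (n0 <= nk k0)%N -> exists S : R, forall l,
  \sum_(k0.+1 <= k < l) \prod_((nk k0).+1 <= n < (nk k).+1) (1 - lam n) <= S.

Variables x x' : nat -> 'rV[R]_d.
Variable M : R.
Hypothesis xS : forall k, x k.+1 = hlwb N lam (family k) (nk k) (x k) (x' k).
Hypothesis x'M : forall k, enorm (x' k) <= M.

Lemma localize_proj_eq (C : nat -> set 'rV[R]_d) p (r : R) i y :
  closed_convex (C i) ->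
  (inner (C i) p -> forall y, enorm (y - p) <= r -> C i y) ->
  enorm (y - p) <= r -> proj (localize C p i) y = proj (C i) y.
Proof.
move=> cCi Cr yr; rewrite /localize; case: asboolP => // Ci.
rewrite proj_id ?(proj_id cCi)//; first exact: Cr.
by apply: halfspace_or_full_closed_convex; right.
Qed.

(* x is compared with an orbit y of the localized system: from the index where
   both follow the same projections on, one half-step contracts x k - y k up to
   a summable relative error. *)
Lemma generic_quasi_fejer a : generic N A B v a ->
  proj (polyhedron N B) a = a + v -> proj (polyhedron N A) (a + v) = a ->
  forall e : R, 0 < e -> exists K, forall k l, (K <= k)%N -> (k <= l)%N ->
    enorm (x l - target a l) <= enorm (x k - target a k) + e.
Proof.
move=> ga Ba Av e e0; have [Ea _] := ga.
have [r [r0 Ar]] := localize_radius N A a.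
have [s [s0 Bs]] := localize_radius N B (a + v).
have e4 : 0 < e / 4 by lra.
pose eps := Num.min (e / 4) (Num.min r s).
have eps0 : 0 < eps by rewrite !lt_min e4 r0.
have epse : eps <= e / 4 by rewrite ge_min lexx.
have epsr : eps <= r by rewrite !ge_min lexx orbT.
have epss : eps <= s by rewrite !ge_min lexx !orbT.
clearbody eps.
have agree k i y : (1 <= i <= N)%N -> enorm (y - target a k.+1) <= eps ->
    proj (local_family a k i) y = proj (family k i) y.
  move=> iN yeps; rewrite /local_family /family /target /= in yeps *.
  move: yeps; case: odd => /= yeps.
    apply: (localize_proj_eq (r := r)) => [|Ai|].
    - exact: halfspace_or_full_closed_convex (hA iN).
    - exact: Ar.
    - exact: le_trans epsr.
  apply: (localize_proj_eq (r := s)) => [|Bi|].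
  - exact: halfspace_or_full_closed_convex (hB iN).
  - exact: Bs.
  - exact: le_trans epss.
have [K1 stable] := reference_stable ga Ba Av eps0.
have [K2 nkK2] := nkoo n0.
pose K0 := (maxn K1 K2).*2.
have K1K0 : (K1 <= K0)%N by rewrite /K0 -addnn (leq_trans (leq_maxl K1 K2))// leq_addr.
have K2K0 : (K2 <= K0)%N by rewrite /K0 -addnn (leq_trans (leq_maxr K1 K2))// leq_addr.
have evK0 : ~~ odd K0 by rewrite odd_double.
have n0m : (n0 <= nk K0)%N by exact: nkK2.
clearbody K0.
have [y [yK0 yS]] := orbit_exists (fun k z =>
  hlwb N lam (local_family a k) (nk k) z (target a k.+1)) K0 (target a K0).
have yP := stable K0 K1K0 evK0 y yK0 yS.
have [L [L1 HL]] := @hlwb_lipschitz R d N lam n0 N0 lam01.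
(* Weight with which half-step [k] remembers its inner iterate of index [nk K0]. The comparison
   starts there because only from then on are the inner iterates of [y] known to be near the
   target. *)
pose w k := \prod_((nk K0).+1 <= n < (nk k).+1) (1 - lam n).
have l01' i : ((nk K0).+1 <= i)%N -> 0 <= lam i <= 1.
  by move=> /ltnW mi; apply: lam01; exact: leq_trans mi.
(* At inner index [nk K0] the two orbits differ by at most [L * enorm (x k - y k) + c]: the
   Lipschitz bound compares the orbit of [x] with the fixed point [target a k.+1], and [eps] covers
   that of [y]. *)
pose c := L * (eps + enorm v + (M + (enorm a + enorm v))) + eps.
have M0 : 0 <= M by exact: le_trans (enorm_ge0 _) (x'M 0%N).
have c0 : 0 <= c.
  rewrite addr_ge0 ?(ltW eps0)// mulr_ge0//; first lra.
  by have := enorm_ge0 v; have := enorm_ge0 a; lra.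
have step k : (K0 <= k)%N ->
    enorm (x k.+1 - y k.+1) <= enorm (x k - y k) + w k * (L * enorm (x k - y k) + c).
  move=> K0k; have [yk zk] := yP k K0k.
  have := recursion_contract (T := fun i => proj (family k (mod1 N i.+1)))
    (z := fun n => hlwb N lam (family k) n (x k) (x' k))
    (z' := fun n => hlwb N lam (local_family a k) n (y k) (target a k.+1))
    lam01 (fun i x y => proj_nonexp x y (cF k (mod1_bounds i.+1 N0)))
    n0m (nk_homo K0k) (fun i _ => erefl).
  have z'S i : (nk K0 <= i < nk k)%N ->
      hlwb N lam (local_family a k) i.+1 (y k) (target a k.+1) =
      lam i.+1 *: y k + (1 - lam i.+1) *: proj (family k (mod1 N i.+1))
        (hlwb N lam (local_family a k) i (y k) (target a k.+1)).
    move=> /andP[mi _]; rewrite /= agree//; first exact: mod1_bounds.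
    exact: zk.
  move=> /(_ _ z'S); rewrite -xS -yS// -/(w k).
  have w0 : 0 <= w k by exact: prod1B_ge0.
  have := zk (nk K0) (leqnn _).
  have := HL (family k) (cF k) (nk K0) (x k) (target a k.+1) (x' k) (target a k.+1).
  rewrite (hlwb_fixed _ N0 _ (cF k) (target_in k Ea)).
  have tt : enorm (target a k - target a k.+1) <= enorm v.
    rewrite /target /=; case: odd => /=.
      by rewrite addrAC subrr add0r.
    by rewrite opprD addrA subrr add0r enormN.
  have := enormB_le (x' k) (target a k.+1); have := x'M k.
  have := target_le a k.+1.
  have := enorm_triangle (y k) (x k) (target a k.+1).
  have := enorm_triangle (target a k) (y k) (target a k.+1).
  move: (target a k) (target a k.+1) yk tt => p q yk tt.
  move: (x k) (y k) (x' k) yk => xk yk x'k ykp.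
  move: (hlwb _ _ (local_family a k) _ _ _) (hlwb _ _ (family k) _ _ _) => z1 z2.
  have := enorm_triangle q z2 z1; rewrite (enormC q z1).
  move: (w k) w0 => wk w0.
  move=> h1 h2 h3 h4 h5 h6 h7 h8 h9.
  have D0 := enorm_ge0 (xk - yk).
  have : L * (enorm (xk - q) + enorm (x'k - q)) <=
      L * (enorm (xk - yk) + (eps + enorm v + (M + (enorm a + enorm v)))).
    by rewrite ler_wpM2l//; lra.
  rewrite mulrDr => h10.
  have : wk * enorm (z2 - z1) <= wk * (L * enorm (xk - yk) + c).
    by rewrite ler_wpM2l// /c; lra.
  have := mulr_ge0 w0 D0; lra.
have [S wS] := prod_sum n0m.
(* The summability hypothesis starts at [K0.+1], hence this choice of [m]. *)
have [K qd] := quasi_decreasing (m := K0.+1) (lt_le_trans ltr01 L1) c0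
  (fun k => enorm_ge0 (x k - y k)) (fun k _ => prod1B_ge0 _ l01')
  (ex_intro _ S wS) (fun k K0k => step k (ltnW K0k)) (divr_gt0 e0 (ltr0n _ 2)).
exists (maxn K0 K) => k l; rewrite geq_max => /andP[K0k Kk] kl.
have := qd k l Kk kl; have [yk _] := yP k K0k; have [yl _] := yP l (leq_trans K0k kl).
have := enorm_triangle (y l) (x l) (target a l).
have := enorm_triangle (target a k) (x k) (y k).
by rewrite (enormC (target a k)); lra.
Qed.

Hypothesis v_min : forall y z, polyhedron N A y -> polyhedron N B z ->
  enorm v <= enorm (y - z).
Hypothesis pair_exists : exists e, translation_pair N A B v e.

Lemma translation_pair_proj e : translation_pair N A B v e ->
  proj (polyhedron N B) e = e + v /\ proj (polyhedron N A) (e + v) = e.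
Proof.
move=> [Ae Be].
have cPA : closed_convex (polyhedron N A).
  by apply: polyhedron_closed_convex; [exact: cF 1%N|exists e].
have cPB : closed_convex (polyhedron N B).
  by apply: polyhedron_closed_convex; [exact: cF 0%N|exists (e + v)].
apply: (best_approx_pair_proj cPA cPB); split=> // y z Ay Bz.
by rewrite opprD addrA subrr add0r enormN; exact: v_min.
Qed.

(** Genericity is removed by replacing [p] with a generic [q] whose targets are within [e / 3] of
    those of [p]. *)
Lemma quasi_fejer p : translation_pair N A B v p ->
  forall e : R, 0 < e -> exists K, forall k l, (K <= k)%N -> (k <= l)%N ->
    enorm (x l - target p l) <= enorm (x k - target p k) + e.
Proof.
move=> Ep e e0; have [a ga] := generic_exists hA hB Ep.
have e3 : 0 < e / 3 by lra.
have ap := enorm_ge0 (a - p).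
have eap : 0 < e / 3 + enorm (a - p) by lra.
pose t := e / 3 / (e / 3 + enorm (a - p)).
have t0 : 0 < t by rewrite divr_gt0.
have t01 : 0 < t <= 1 by rewrite t0/= ler_pdivrMr//; lra.
have te : t * enorm (a - p) <= e / 3.
  by rewrite /t mulrAC ler_pdivrMr// ler_wpM2l ?lerDr// ltW.
pose q := t *: a + (1 - t) *: p.
have gq : generic N A B v q := generic_segment hA hB ga Ep t01.
have [Bq Aq] := translation_pair_proj (proj1 gq).
have [K HK] := generic_quasi_fejer gq Bq Aq e3.
have qp k : enorm (target q k - target p k) <= e / 3.
  have -> : target q k - target p k = t *: (a - p).
    by rewrite /target; case: odd; apply/rowP => i; rewrite !mxE; ring.
  by rewrite enormZ gtr0_norm.
exists K => k l Kk kl; have := HK k l Kk kl; have := qp k; have := qp l.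
have := enorm_triangle (target q l) (x l) (target p l).
have := enorm_triangle (target p k) (x k) (target q k).
by rewrite (enormC (target p k)); lra.
Qed.

Lemma alternation_converges : exists p, translation_pair N A B v p /\
  forall e : R, 0 < e -> exists K, forall k, (K <= k)%N ->
    enorm (x k - target p k) <= e.
Proof.
have [a Ea] := pair_exists; have [Aa Bav] := Ea.
have cP k : closed_convex (polyhedron N (family k)).
  apply: polyhedron_closed_convex; first exact: cF.
  by exists (target a k.+1); exact: target_in.
have [Ba Av] := translation_pair_proj Ea.
have [K1 HK1] := quasi_fejer Ea ltr01.
pose b := enorm (x K1 - target a K1) + 1 + (enorm a + enorm v).
have xb k : (K1 <= k)%N -> enorm (x k) <= b.
  move=> K1k; have := HK1 K1 k (leqnn _) K1k; have := target_le a k.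
  by have := enormD (x k - target a k) (target a k); rewrite subrK /b; lra.
have F0 k : polyhedron N (family k) !=set0 by have [] := cP k.
have Fodd k : family k = family (odd k) by rewrite /family oddb.
have near_proj : forall e : R, 0 < e -> exists K, forall k, (K <= k)%N ->
    enorm (x k.+1 - proj (polyhedron N (family k)) (x k)) <= e.
  move=> e e0; have [K HK] := hlwb_cvg_uniform_parity (Num.max b M) cF F0 Fodd e0.
  have [K2 nkK2] := nkoo K; exists (maxn K1 K2) => k; rewrite geq_max => /andP[K1k K2k].
  rewrite xS; apply: HK; first exact: nkK2.
    by rewrite le_max xb.
  by rewrite le_max x'M orbT.
have [|p clp] := enorm_cluster (x := fun j => x (K1 + j).*2) (M := b).
  by move=> j; apply: xb; rewrite -addnn -addnA leq_addr.
have {}clp (e : R) (K : nat) : 0 < e ->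
    exists j, (K <= j.*2)%N /\ enorm (x j.*2 - p) < e.
  move=> e0; have [j [Kj xp]] := clp e e0 K; exists (K1 + j)%N; split=> //.
  by rewrite (leq_trans Kj)// (leq_trans (leq_addl K1 j))// -addnn leq_addr.
(* The cluster point loses no distance to [a] over a cycle: later iterates return near [p], yet by
   quasi-Fejer monotonicity they are hardly farther from [a] than the image of [p]. *)
have [|Ap Bp] := alternating_isometric (x := p) (cP 1%N) (cP 0%N) Ba Av.
  rewrite /family /=; apply: le_of_lt_addr => e e0.
  have e6 : 0 < e / 6 by lra.
  have [K2 HK2] := quasi_fejer Ea e6.
  have [K3 HK3] := near_proj _ e6.
  have [i [Ki xi]] := clp _ (maxn K2 K3) e6.
  have [j [ij xj]] := clp _ i.*2.+2 e6.
  move: Ki; rewrite geq_max => /andP[K2i K3i].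
  have := HK2 i.*2.+2 j.*2 (leq_trans K2i (leqW (leqW (leqnn _)))) ij.
  have := HK3 i.*2.+1 (leqW K3i); have := HK3 i.*2 K3i.
  rewrite /target /family /= !odd_double /=.
  have := proj_nonexp (x i.*2.+1) (proj (polyhedron N B) (x i.*2)) (cP 1%N).
  have := proj_nonexp (proj (polyhedron N B) (x i.*2))
    (proj (polyhedron N B) p) (cP 1%N).
  have := proj_nonexp (x i.*2) p (cP 0%N); rewrite /family /=.
  move: (x i.*2) (x i.*2.+1) (x i.*2.+2) (x j.*2) xi xj => x0 x1 x2 x3 xi xj.
  have := enorm_triangle x3 p a; rewrite (enormC p x3).
  move: (proj _ p) (proj _ x0) => p1 y1.
  move: (proj _ p1) (proj _ y1) (proj _ x1) => p2 y2 y3.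
  have := enorm_triangle y3 x2 a; have := enorm_triangle y2 y3 a.
  have := enorm_triangle p2 y2 a; lra.
have Ep : translation_pair N A B v p.
  by split; [exact: Ap|move: Bp; rewrite addrAC subrr add0r].
exists p; split=> // e e0; have e2 : 0 < e / 2 by lra.
have [K HK] := quasi_fejer Ep e2; have [j [Kj xj]] := clp _ K e2.
exists j.*2 => k jk; have := HK _ k Kj jk.
by rewrite {2}/target odd_double; lra.
Qed.

End Alternation.

(** * From series and limits to partial sums and thresholds *)

Lemma nneseries_bounded (R : realType) (f : nat -> R) (m : nat) :
  (forall n, (m <= n)%N -> 0 <= f n) -> (\sum_(m <= n <oo) (f n)%:E < +oo)%E ->
  exists S : R, forall n, \sum_(m <= i < n) f i <= S.
Proof.
move=> f0 foo; have le n : ((\sum_(m <= i < n) f i)%:E <= \sum_(m <= n <oo) (f n)%:E)%E.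
  rewrite -sumEFin; apply: (@nneseries_lim_ge R (fun n => (f n)%:E) xpredT).
  by move=> k mk _; rewrite lee_fin f0.
move: foo le; case: (\sum_(m <= n <oo) _)%E => [S _ le| |_ le] //.
- by exists S => n; rewrite -lee_fin.
- by have := le 0%N.
Qed.

Lemma partial_sums_unbounded (R : realType) (l : nat -> R) :
  (\sum_(1 <= i < n) l i) @[n --> \oo] --> +oo ->
  forall m (M : R), exists n, M <= \sum_(m <= i < n) l i.
Proof.
move=> /cvgryPge loo m M.
(* The absolute values absorb the change of lower bound from 1 to [m], the term [l 0] being the case
   [m = 0]. *)
have [K _ HK] := loo (M + `|l 0%N| + `|\sum_(1 <= i < m) l i|).
exists (maxn K m.+1); have mK : (m < maxn K m.+1)%N by exact: leq_maxr.
have := HK (maxn K m.+1) (leq_maxl _ _).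
case: m mK {HK} => [|m] mK.
  rewrite (@big_ltn _ _ _ 0)//=.
  have := ler_norm (- l 0%N); rewrite normrN.
  by have := normr_ge0 (\sum_(1 <= i < 0) l i); lra.
rewrite (@big_cat_nat _ _ _ m.+1 1 (maxn K m.+2))//=; last exact: ltnW.
have := ler_norm (\sum_(1 <= i < m.+1) l i); have := normr_ge0 (l 0%N); lra.
Qed.

Lemma enorm_cvg (R : realType) (d : nat) (x : nat -> 'rV[R]_d) (p : 'rV[R]_d) :
  (forall e : R, 0 < e -> exists K, forall k, (K <= k)%N -> enorm (x k - p) <= e) ->
  x k @[k --> \oo] --> p.
Proof.
move=> xp; apply/cvgrPdist_le => e e0; have [K HK] := xp e e0.
exists K => // k /= Kk; rewrite (le_trans (norm_le_enorm _))// enormC.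
exact: HK.
Qed.

Theorem theorem1 (R : realType) (d N : nat) (A B : nat -> set 'rV[R]_d)
  (lam : nat -> R) (nk : nat -> nat) (a b a' b' : nat -> 'rV[R]_d) :
  (0 < N)%N ->
  (forall i, (1 <= i <= N)%N -> halfspace_or_full (A i)) ->
  (forall j, (1 <= j <= N)%N -> halfspace_or_full (B j)) ->
  polyhedron N A !=set0 ->
  polyhedron N B !=set0 ->
  (* lam is a sequence of parameters indexed from 1 *)
  (\forall n \near \oo, 0 <= lam n) ->
  lam n @[n --> \oo] --> 0 ->
  (\sum_(1 <= i < n) lam i) @[n --> \oo] --> +oo ->
  (\sum_(1 <= n <oo) (`|lam n - lam (n + N)%N|)%:E < +oo)%E ->
  {homo nk : k l / (k <= l)%N} ->
  nk k @[k --> \oo] --> \oo ->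
  (ereal_sup (range (fun k0 : nat =>
     \sum_(k0.+1 <= k <oo)
        (\prod_((nk k0).+1 <= n < (nk k).+1) (1 - lam n))%:E)) < +oo)%E ->
  (* the auxiliary sequence a'_0, b'_1, a'_2, b'_3, ... is bounded *)
  (exists M : R, forall k,
     enorm (a' k.*2) <= M /\ enorm (b' k.*2.+1) <= M) ->
  (* a_0 is arbitrary *)
  (forall k, ~~ odd k -> b k.+1 = hlwb N lam B (nk k) (a k) (a' k)) ->
  (forall k, odd k -> a k.+1 = hlwb N lam A (nk k) (b k) (b' k)) ->
  exists abar bbar : 'rV[R]_d,
    best_approx_pair (polyhedron N A) (polyhedron N B) abar bbar /\
    (a k.*2, b k.*2.+1) @[k --> \oo] --> (abar, bbar).
Proof.
move=> N0 hA hB A0 B0 [n1 _ lamge0] lamto0 lamoo lamvar nk_homo nkoo prods.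
move=> [M auxM] bS aS.
have lam0 e : 0 < e -> exists K, forall n, (K <= n)%N -> lam n <= e.
  move=> e0; have /cvgr0Pnorm_le/(_ e e0)[K _ HK] := lamto0.
  by exists K => n Kn; rewrite (le_trans (ler_norm _))// HK.
have [n2 lamle1] := lam0 1 ltr01.
have lam01 n : (maxn n1 n2 <= n)%N -> 0 <= lam n <= 1.
  by rewrite geq_max => /andP[n1n n2n]; rewrite lamle1// andbT; exact: lamge0.
have lamN := nneseries_bounded (fun n _ => normr_ge0 _) lamvar.
have {}nkoo m : exists K, forall k, (K <= k)%N -> (m <= nk k)%N.
  have [|K _ HK] := nkoo [set n | (m <= n)%N]; first by exists m.
  by exists K.
have prod_sum k0 : (maxn n1 n2 <= nk k0)%N -> exists S : R, forall l,
    \sum_(k0.+1 <= k < l) \prod_((nk k0).+1 <= n < (nk k).+1) (1 - lam n) <= S.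
  move=> n0k0; apply: nneseries_bounded.
    move=> k _; apply: prod1B_ge0 => i k0i; apply: lam01.
    by rewrite (leq_trans n0k0)// ltnW.
  by apply: le_lt_trans prods; apply: ereal_sup_ubound; exists k0.
have [a0 [b0 [Aa0 Bb0 abmin]]] := best_approx_pair_exists hA hB A0 B0.
pose v := b0 - a0.
have v_min y z : polyhedron N A y -> polyhedron N B z -> enorm v <= enorm (y - z).
  by move=> Ay Bz; rewrite /v enormC; exact: abmin.
have pair0 : exists e, translation_pair N A B v e.
  by exists a0; split=> //; rewrite addrC subrK.
(* The two sequences are interleaved into one, indexed by half-steps. *)
pose x k := if odd k then b k else a k.
pose x' k := if odd k then b' k else a' k.
have xS k : x k.+1 = hlwb N lam (family A B k) (nk k) (x k) (x' k).
  rewrite /x /x' /family /=; have := @aS k; have := @bS k.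
  by case: odd => /= [_ ->|->].
have x'M k : enorm (x' k) <= M.
  have [aM bM] := auxM k./2; rewrite /x'; have := odd_double_half k.
  by case: odd => /= kE; [rewrite add1n in kE|rewrite add0n in kE]; rewrite -kE.
have [p [[Ap Bp] xp]] := alternation_converges N0 hA hB lam01 lam0
  (partial_sums_unbounded lamoo) lamN nk_homo nkoo prod_sum xS x'M v_min pair0.
exists p, (p + v); split.
  split=> // y z Ay Bz; rewrite opprD addrA subrr add0r enormN.
  exact: v_min.
apply: (@cvg_pair _ _ _ \oo (nbhs p) (nbhs (p + v))); apply: enorm_cvg => e e0;
  have [K HK] := xp e e0; exists K => k Kk.
  have := HK k.*2; rewrite /x /target odd_double; apply.
  by rewrite -addnn (leq_trans Kk)// leq_addr.
have := HK k.*2.+1; rewrite /x /target /= odd_double; apply.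
by rewrite leqW// -addnn (leq_trans Kk)// leq_addr.
Qed.
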